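(* Let $p\ge 1$ be an integer. Then for all sufficiently large $n$, $SPEX_P(n,K_2+pK_2)=\{2K_1+C_{n-2}\}$.
   Context: All graphs are finite and simple. A graph is $F$-free if it has no subgraph isomorphic to $F$. The spectral radius of a graph is the largest eigenvalue of its adjacency matrix. $SPEX_P(n,F)$ denotes the set of $n$-vertex $F$-free planar graphs whose spectral radius is maximum among all $n$-vertex $F$-free planar graphs (up to isomorphism). $K_m$, $C_m$ denote the complete graph and cycle on $m$ vertices; $pK_2$ is the disjoint union of $p$ edges. The join $G_1+G_2$ of vertex-disjoint graphs is obtained from $G_1\cup G_2$ by adding all edges between $V(G_1)$ and $V(G_2)$; $2K_1$ is two nonadjacent vertices. *)

(* Defs.v *)
From HB Require Import structures.
From mathcomp Require Import all_boot all_order all_algebra.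
From mathcomp Require Import all_classical all_reals all_analysis.
Import Order.TTheory GRing.Theory Num.Theory.
Import numFieldNormedType.Exports.

Set Implicit Arguments.
Unset Strict Implicit.
Unset Printing Implicit Defensive.

Local Open Scope classical_set_scope.
Local Open Scope ring_scope.

Record sgraph := SGraph {
  vertex :> finType;
  adj : rel vertex;
  adj_sym : symmetric adj;
  adj_irr : irreflexive adj }.

Definition isomorphic (G H : sgraph) : Prop :=
  exists2 f : G -> H, bijective f & forall x y, adj (f x) (f y) = adj x y.

(* The subgraph need not be induced: edges of F are preserved, not reflected. *)
Definition contains (G F : sgraph) : Prop :=
  exists2 f : F -> G, injective f & forall x y, adj x y -> adj (f x) (f y).

Definition free (F G : sgraph) : Prop := ~ contains G F.

Section Complete.
Variable m : nat.

Definition complete_adj : rel 'I_m := fun i j => i != j.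

Lemma complete_adj_sym : symmetric complete_adj.
Proof. by move=> i j; rewrite /complete_adj eq_sym. Qed.

Lemma complete_adj_irr : irreflexive complete_adj.
Proof. by move=> i; rewrite /complete_adj eqxx. Qed.

Definition complete : sgraph := SGraph complete_adj_sym complete_adj_irr.
End Complete.

Section Cycle.
Variable m : nat.

(* This is the cycle C_m when m >= 3; the disequality only matters for m = 1. *)
Definition cycle_adj : rel 'I_m := fun i j =>
  (i != j) && ((i.+1 == j %[mod m])%N || (j.+1 == i %[mod m])%N).

Lemma cycle_adj_sym : symmetric cycle_adj.
Proof. by move=> i j; rewrite /cycle_adj eq_sym orbC. Qed.

Lemma cycle_adj_irr : irreflexive cycle_adj.
Proof. by move=> i; rewrite /cycle_adj eqxx. Qed.

Definition cycle_graph : sgraph := SGraph cycle_adj_sym cycle_adj_irr.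
End Cycle.

Section Copies.
Variables (k : nat) (G : sgraph).

Definition copies_adj : rel ('I_k * G)%type := fun x y =>
  (x.1 == y.1) && adj x.2 y.2.

Lemma copies_adj_sym : symmetric copies_adj.
Proof. by move=> x y; rewrite /copies_adj eq_sym adj_sym. Qed.

Lemma copies_adj_irr : irreflexive copies_adj.
Proof. by move=> x; rewrite /copies_adj adj_irr andbF. Qed.

(* The disjoint union kG of k copies of G. *)
Definition copies : sgraph := SGraph copies_adj_sym copies_adj_irr.
End Copies.

Section Join.
Variables G H : sgraph.

Definition join_adj : rel (G + H)%type := fun x y =>
  match x, y with
  | inl u, inl v => adj u v
  | inr u, inr v => adj u v
  | _, _ => true
  end.

Lemma join_adj_sym : symmetric join_adj.
Proof. by case=> u [] v //=; rewrite adj_sym. Qed.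

Lemma join_adj_irr : irreflexive join_adj.
Proof. by case=> u /=; rewrite adj_irr. Qed.

Definition join : sgraph := SGraph join_adj_sym join_adj_irr.
End Join.

Section Planarity.
Variable R : realType.

Definition is_arc (A : set (R * R)) (a b : R * R) : Prop :=
  exists g : R -> R * R,
    [/\ {within `[0, 1], continuous g},
        set_inj `[0, 1] g,
        g 0 = a, g 1 = b
      & A = g @` `[0, 1]].

(* A plane drawing: the vertex z is the point pos z and the edge xy is the
   arc curve [set x; y]; curve is irrelevant on the other sets.  The interior
   of an edge meets no vertex and no other edge. *)
Record drawing (G : sgraph) (pos : G -> R * R)
    (curve : {set G} -> set (R * R)) : Prop := Drawing {
  drawing_inj : injective pos;
  drawing_arc : forall x y, adj x y ->
    is_arc (curve [set x; y]%SET) (pos x) (pos y);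
  drawing_vertex : forall x y z, adj x y ->
    curve [set x; y]%SET (pos z) -> z = x \/ z = y;
  drawing_edge : forall x y u v, adj x y -> adj u v ->
    [set x; y]%SET <> [set u; v]%SET ->
    curve [set x; y]%SET `&` curve [set u; v]%SET `<=` range pos }.

Definition planar (G : sgraph) : Prop :=
  exists (pos : G -> R * R) (curve : {set G} -> set (R * R)),
    drawing pos curve.
End Planarity.

Section Spectral.
Variable R : realType.

Definition adjmx (G : sgraph) : 'M[R]_#|G| :=
  \matrix_(i, j) (adj (enum_val i) (enum_val j))%:R.

(* The adjacency matrix is real symmetric, so for a graph with a vertex this
   is the supremum of a nonempty finite set, that is, its maximum. *)
Definition spectral_radius (G : sgraph) : R :=
  sup [set a : R | eigenvalue (adjmx G) a].

Definition free_planar (n : nat) (F G : sgraph) : Prop :=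
  [/\ #|G| = n, free F G & planar R G].

(* Membership of G in SPEX_P(n, F), a class closed under isomorphism; sgraph
   is too large a type for its subclasses to be put in (set sgraph). *)
Definition SPEX_P (n : nat) (F G : sgraph) : Prop :=
  free_planar n F G /\
  forall H, free_planar n F H -> spectral_radius H <= spectral_radius G.
End Spectral.

(* Main.v *)
(* Planarity is used only through its mod 2 shadow.  Given a drawing, let w(ab, c)
   be the parity of the number of times the direction from c to a point running
   along the edge ab crosses the positive x-axis.  For two disjoint edges ab and
   cd the direction between a point of one and a point of the other never
   vanishes on the square [0,1] x [0,1], so its crossing parity around the
   boundary is zero; this expresses w(ab,c) + w(ab,d) + w(cd,a) + w(cd,b) through
   a tournament h on the vertices.  Such systems (h, w) survive edge contraction
   and exist neither for K_5 nor for K_{3,3}, so Mader's contraction argument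
   bounds the number of edges of every subgraph linearly.

   Let x be a Perron vector with maximum 1, attained at u, and suppose that the
   spectral radius rho is at least the root 2 t + 2 of t (2 t + 2) = n - 2 given
   by 2 K_1 + C_{n-2}.  Since rho^2 >= 2 n and only boundedly many entries of x
   exceed eps, counting walks of length 2 from u, with K_{3,3}-freeness, yields a
   second vertex w with x w close to 1 such that u and w have (1 - O(eps)) n
   common neighbours, while all other entries are O(eps).  Pairing the eigenvalue
   equation with the vector (t, t, 1, ..., 1) then shows: if u and w are adjacent,
   their common neighbourhood has a bounded number of edges for lack of a
   p-matching, and rho is too small; otherwise every other vertex is adjacent to
   both u and w, and these vertices induce a 2-regular graph.  It is connected,
   for otherwise contracting an edge from u to another component would give a K_5
   minor. *)

From HB Require Import structures.
From mathcomp Require Import all_boot all_order all_algebra.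
From mathcomp Require Import all_classical all_reals all_analysis.
From mathcomp Require Import zify ssrAC lra ring.
Import Order.TTheory GRing.Theory Num.Theory.
Import numFieldNormedType.Exports.
Require Import Defs.

Set Implicit Arguments.
Unset Strict Implicit.
Unset Printing Implicit Defensive.

(** * Mod 2 planarity and forbidden minors *)

(* In a plane drawing [h x y] tells whether [y] is lexicographically below [x], and
   [w a b c] is the parity of the number of times the direction from [c] to a point
   moving from [a] to [b] along the edge crosses the positive x-axis. *)
Definition mod2_planar (V : finType) (r : rel V) : Prop :=
  [/\ symmetric r, irreflexive r &
    exists (h : rel V) (w : V -> V -> V -> bool),
      (forall x y, x != y -> h x y = ~~ h y x) /\
      forall a b c d, r a b -> r c d -> uniq [:: a; b; c; d] ->
        w a b c (+) w a b d (+) w c d a (+) w c d b =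
        h a c (+) h a d (+) h b c (+) h b d].

(** Turns relations mod 2 into evenness of sums of naturals, which [lia] can add up. *)
Lemma addb_parity (a b c d e f g i : bool) :
  a (+) b (+) c (+) d = e (+) f (+) g (+) i ->
  exists k : nat, a + b + c + d + e + f + g + i = k.*2.
Proof.
move=> E; exists (a + b + c + d + e + f + g + i)./2; rewrite even_halfK //.
by rewrite !oddD !oddb E; case: e f g i {E} => [] [] [] [].
Qed.

Ltac solve_uniq :=
  match goal with U : is_true (uniq _) |- _ =>
    move: U; rewrite /= !inE !negb_or -!andbA;
    repeat (case/andP => ? ); move=> *;
    repeat (apply/andP; split); by [|rewrite eq_sym] end.

Ltac mod2_lia :=
  repeat match goal with H : context [nat_of_bool ?b] |- _ =>
    let m := fresh "m" in set (m := nat_of_bool b) in *; clearbody m end;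
  lia.

Section Mod2Planar.
Variables (V : finType) (r : rel V).
Hypothesis rP : mod2_planar r.

Lemma mod2_planar_sum : exists (h : V -> V -> nat) (w : V -> V -> V -> nat),
  (forall x y, x != y -> h x y + h y x = 1) /\
  forall a b c d, r a b -> r c d -> uniq [:: a; b; c; d] ->
    exists k, w a b c + w a b d + w c d a + w c d b +
              h a c + h a d + h b c + h b d = k.*2.
Proof.
case: rP => _ _ [h [w [hT hw]]].
exists (fun x y => h x y), (fun x y z => w x y z).
split=> [x y /hT -> | a b c d ab cd u]; first by case: (h y x).
by apply: addb_parity; apply: hw.
Qed.

(* Summing the relation over all pairs of disjoint edges, each crossing number
   [w] occurs twice, while the [h] terms add up to an odd number. *)
Lemma mod2_planar_K5_free a b c d e : uniq [:: a; b; c; d; e] ->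
  [&& r a b, r a c, r a d & r a e] -> [&& r b c, r b d & r b e] ->
  [&& r c d, r c e & r d e] -> False.
Proof.
move=> U /and4P[ab ac ad ae] /and3P[bc bd be] /and3P[cd ce de].
have [h [w [hT hw]]] := mod2_planar_sum.
have [k0 E0] := hw _ _ _ _ ab cd ltac:(solve_uniq).
have [k1 E1] := hw _ _ _ _ ab ce ltac:(solve_uniq).
have [k2 E2] := hw _ _ _ _ ab de ltac:(solve_uniq).
have [k3 E3] := hw _ _ _ _ ac bd ltac:(solve_uniq).
have [k4 E4] := hw _ _ _ _ ac be ltac:(solve_uniq).
have [k5 E5] := hw _ _ _ _ ac de ltac:(solve_uniq).
have [k6 E6] := hw _ _ _ _ ad bc ltac:(solve_uniq).
have [k7 E7] := hw _ _ _ _ ad be ltac:(solve_uniq).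
have [k8 E8] := hw _ _ _ _ ad ce ltac:(solve_uniq).
have [k9 E9] := hw _ _ _ _ ae bc ltac:(solve_uniq).
have [k10 E10] := hw _ _ _ _ ae bd ltac:(solve_uniq).
have [k11 E11] := hw _ _ _ _ ae cd ltac:(solve_uniq).
have [k12 E12] := hw _ _ _ _ bc de ltac:(solve_uniq).
have [k13 E13] := hw _ _ _ _ bd ce ltac:(solve_uniq).
have [k14 E14] := hw _ _ _ _ be cd ltac:(solve_uniq).
have Tbc := hT b c ltac:(solve_uniq).
have Tbd := hT b d ltac:(solve_uniq).
have Tbe := hT b e ltac:(solve_uniq).
have Tcd := hT c d ltac:(solve_uniq).
have Tce := hT c e ltac:(solve_uniq).
have Tde := hT d e ltac:(solve_uniq).
clear -E0 E1 E2 E3 E4 E5 E6 E7 E8 E9 E10 E11 E12 E13 E14 Tbc Tbd Tbe Tcd Tce Tde; mod2_lia.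
Qed.

(** Over the 18 pairs of disjoint edges every [w] term again occurs twice. Each two of [d], [e], [f]
    contribute [h] three times in either direction, 9 in all; the other [h] terms add up to an even
    number. *)
Lemma mod2_planar_K33_free a b c d e f : uniq [:: a; b; c; d; e; f] ->
  [&& r a d, r a e & r a f] -> [&& r b d, r b e & r b f] ->
  [&& r c d, r c e & r c f] -> False.
Proof.
move=> U /and3P[ad ae af] /and3P[bd be bf] /and3P[cd ce cf].
have [h [w [hT hw]]] := mod2_planar_sum.
have [k0 E0] := hw _ _ _ _ ad be ltac:(solve_uniq).
have [k1 E1] := hw _ _ _ _ ad bf ltac:(solve_uniq).
have [k2 E2] := hw _ _ _ _ ad ce ltac:(solve_uniq).
have [k3 E3] := hw _ _ _ _ ad cf ltac:(solve_uniq).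
have [k4 E4] := hw _ _ _ _ ae bd ltac:(solve_uniq).
have [k5 E5] := hw _ _ _ _ ae bf ltac:(solve_uniq).
have [k6 E6] := hw _ _ _ _ ae cd ltac:(solve_uniq).
have [k7 E7] := hw _ _ _ _ ae cf ltac:(solve_uniq).
have [k8 E8] := hw _ _ _ _ af bd ltac:(solve_uniq).
have [k9 E9] := hw _ _ _ _ af be ltac:(solve_uniq).
have [k10 E10] := hw _ _ _ _ af cd ltac:(solve_uniq).
have [k11 E11] := hw _ _ _ _ af ce ltac:(solve_uniq).
have [k12 E12] := hw _ _ _ _ bd ce ltac:(solve_uniq).
have [k13 E13] := hw _ _ _ _ bd cf ltac:(solve_uniq).
have [k14 E14] := hw _ _ _ _ be cd ltac:(solve_uniq).
have [k15 E15] := hw _ _ _ _ be cf ltac:(solve_uniq).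
have [k16 E16] := hw _ _ _ _ bf cd ltac:(solve_uniq).
have [k17 E17] := hw _ _ _ _ bf ce ltac:(solve_uniq).
have Tde := hT d e ltac:(solve_uniq).
have Tdf := hT d f ltac:(solve_uniq).
have Tef := hT e f ltac:(solve_uniq).
have Tab := hT a b ltac:(solve_uniq).
have Tac := hT a c ltac:(solve_uniq).
have Tbc := hT b c ltac:(solve_uniq).
clear -E0 E1 E2 E3 E4 E5 E6 E7 E8 E9 E10 E11 E12 E13 E14 E15 E16 E17 Tde Tdf Tef Tab Tac Tbc; mod2_lia.
Qed.

End Mod2Planar.

(** The terms [m], [m1] and [m2] at the middle vertex of a path occur in the relations of both its
    edges and cancel. *)
Lemma addb_path (a1 b1 c m a2 b2 d p q m1 m2 s t : bool) :
  a1 (+) b1 (+) c (+) m = p (+) q (+) m1 (+) m2 ->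
  a2 (+) b2 (+) m (+) d = m1 (+) m2 (+) s (+) t ->
  (a1 (+) a2) (+) (b1 (+) b2) (+) c (+) d = p (+) q (+) s (+) t.
Proof.
move=> E1 E2; have := congr2 addb E1 E2.
rewrite (AC (4*4) ((1*5)*(2*6)*3*8*(4*7)))/= addbb addbF => ->.
by rewrite (AC (4*4) (1*2*7*8*(3*5)*(4*6)))/= !addbb !addbF.
Qed.

(** * Edge contraction *)

Section Contraction.
Variables (V : finType) (r : rel V).

Definition contract (u v : V) : rel V := fun x y =>
  [&& x != v, y != v, x != y &
   [|| r x y, (x == u) && r v y | (y == u) && r x v]].

Lemma contract_sym u v : symmetric r -> symmetric (contract u v).
Proof.
move=> rs x y; rewrite /contract [y == x]eq_sym [r y x]rs [r v x]rs [r y v]rs andbCA.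
by case: (r x y) ((x == u) && _) ((y == u) && _) => [] [] []; rewrite ?andbT ?andbF.
Qed.

Lemma contract_irr u v : irreflexive (contract u v).
Proof. by move=> x; rewrite /contract eqxx !andbF. Qed.

(* An edge [u b] created by the contraction stands for the path [u v b]; adding
   the relations of its two edges gives the relation for [u b]. *)
Lemma mod2_planar_contract u v : mod2_planar r -> r u v -> mod2_planar (contract u v).
Proof.
move=> [rs ri [h [w [hT hw]]]] uv; split; [exact: contract_sym|exact: contract_irr|].
exists h, (fun x y z => if r x y then w x y z
  else if x == u then w u v z (+) w v y z else w x v z (+) w v u z).
split=> // a b c d.
have vu : r v u by rewrite rs.
have main x y z t : ~~ r x y -> contract u v x y -> r z t -> z != v -> t != v ->
    uniq [:: x; y; z; t] ->
    let w' := fun p => if x == u then w u v p (+) w v y p else w x v p (+) w v u p in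
    w' z (+) w' t (+) w z t x (+) w z t y = h x z (+) h x t (+) h y z (+) h y t.
  move=> nxy /and4P[xv yv _]; rewrite (negPf nxy) /= => xyE zt zv tv U.
  have sub p q : r p q -> p \in [:: x; v; y] -> q \in [:: x; v; y] ->
      w p q z (+) w p q t (+) w z t p (+) w z t q = h p z (+) h p t (+) h q z (+) h q t.
    move=> pq pP qP; apply: hw => //; move: U; rewrite /= !inE !negb_or -!andbA.
    case/and5P=> _ xz xt yz /and3P[yt zt' _].
    have pq' : p != q by apply: contraTneq pq => ->; rewrite ri.
    rewrite pq' zt' /= andbT; move: pP qP; rewrite !inE.
    by move=> /or3P[]/eqP-> /or3P[]/eqP->; apply/and4P; split=> //; rewrite eq_sym.
  case: ifP => [/eqP xu | nxu] /=.
    have vy : r v y by move: xyE nxy; rewrite xu eqxx /=; case/orP => // /andP[/eqP ->]; rewrite uv.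
    have := sub u v uv; have := sub v y vy; rewrite -xu !inE !eqxx ?orbT => /(_ isT isT) E1 /(_ isT isT) E2.
    exact: addb_path E2 E1.
  have [yu xv'] : y = u /\ r x v by move: xyE; rewrite nxu /= => /andP[/eqP].
  have := sub x v xv'; have := sub v u vu; rewrite -yu !inE !eqxx ?orbT => /(_ isT isT) E1 /(_ isT isT) E2.
  exact: addb_path E2 E1.
move=> ab cd U.
(* Every edge created by the contraction contains [u], so of two disjoint edges at most one is
   new. *)
have key x y z t : contract u v x y -> contract u v z t -> uniq [:: x; y; z; t] -> ~~ r x y -> r z t.
  move=> /and4P[xv yv _ xyE] /and4P[zv tv _ /or3P[//|/andP[/eqP zu _]|/andP[/eqP tu _]]] + nxy;
  move: xyE; rewrite (negPf nxy) /= ?zu ?tu !inE => /orP[]/andP[/eqP -> _];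
  by rewrite eqxx ?orbT ?andbF.
have [ab'|nab] := boolP (r a b); last first.
  have cd' := key _ _ _ _ ab cd U nab.
  by rewrite cd'; case/and4P: (cd) => cv dv _ _; apply: main.
have [cd'|ncd] := boolP (r c d); first exact: hw.
case/and4P: (ab) => av bv _ _.
have U' : uniq [:: c; d; a; b] by rewrite -(rot_uniq 2).
have {}U x y : x \in [:: a; b] -> y \in [:: c; d] -> h y x = ~~ h x y.
  move=> xP yP; apply: hT; apply: contraTneq U => yx; rewrite yx in yP.
  rewrite /= !inE; move: xP yP; rewrite !inE.
  by move=> /orP[]/eqP-> /orP[]/eqP->; rewrite eqxx ?orbT ?andbF.
(* Swapping the two edges negates each of the four [h] terms, which leaves their sum unchanged. *)
have := main c d a b ncd cd ab' av bv U'; cbv zeta.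
rewrite (U a c) ?(U a d) ?(U b c) ?(U b d) ?inE ?eqxx ?orbT //.
rewrite ?ab' ?(negPf ncd) => E /=; rewrite (AC 4 ((3*4)*1*2)) /= E.
by case: (h a c) (h a d) (h b c) (h b d) => [] [] [] [].
Qed.
End Contraction.

(** * Linear bounds on the number of edges *)

Section DegreeSum.
Variable V : finType.
Implicit Types (r : rel V) (U : {set V}).

Definition nbrs r U x : {set V} := [set y in U | r x y].
(** For a graph this is twice the number of edges inside [U]. *)
Definition degsum r U : nat := \sum_(x in U) #|nbrs r U x|.

Lemma nbrs_sum r U x : #|nbrs r U x| = \sum_(y in U) r x y.
Proof.
by rewrite -sum1_card big_mkcond [RHS]big_mkcond; apply: eq_bigr => y _; rewrite inE; case: (y \in U); case: (r x y).
Qed.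

Lemma degsumD1 r U v : symmetric r -> irreflexive r -> v \in U ->
  degsum r U = 2 * #|nbrs r (U :\ v) v| + degsum r (U :\ v).
Proof.
move=> rs ri vU; rewrite /degsum (big_setD1 v) //=.
have -> : #|nbrs r U v| = #|nbrs r (U :\ v) v|.
  by apply: eq_card => y; rewrite !inE; case: eqP => // ->; rewrite ri andbF.
rewrite mul2n -addnn -addnA; congr (_ + _).
rewrite [X in _ = X + _]nbrs_sum -big_split /=; apply: eq_bigr => x _.
by rewrite !nbrs_sum (big_setD1 v) //= rs.
Qed.

Lemma leq_degsum r r' U : (forall x y, x \in U -> y \in U -> r x y -> r' x y) ->
  degsum r U <= degsum r' U.
Proof.
move=> rr'; apply: leq_sum => x xU; apply/subset_leq_card/fintype.subsetP => y.
by rewrite !inE => /andP[yU xy]; rewrite yU rr'.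
Qed.

(** The contraction loses the edge [u v] and merges two edges into one for each common neighbour;
    every lost edge counts twice. *)
Lemma degsum_contract r U u v : symmetric r -> irreflexive r ->
  u \in U -> v \in U -> r u v ->
  degsum r U <= degsum (contract r u v) (U :\ v) + 2 + 2 * #|[set z in U | r u z && r v z]|.
Proof.
move=> rs ri uU vU uv; set r' := contract r u v.
have nuv : u != v by apply: contraTneq uv => ->; rewrite ri.
have r's : symmetric r' by apply: contract_sym.
have r'i : irreflexive r' by apply: contract_irr.
have uU' : u \in U :\ v by rewrite !inE nuv.
rewrite (degsumD1 rs ri vU) (degsumD1 rs ri uU') (degsumD1 r's r'i uU').
set W := U :\ v :\ u.
have W' : degsum r W <= degsum r' W.
  apply: leq_degsum => x y; rewrite !inE => /and3P[xu xv _] /and3P[yu yv _] xy.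
  by rewrite /r' /contract xv yv xy andbT /=; apply: contraTneq xy => ->; rewrite ri.
have -> : #|nbrs r (U :\ v) v| = (#|nbrs r W v|).+1.
  rewrite (cardsD1 u) !inE nuv uU rs uv add1n; congr _.+1.
  by apply: eq_card => y; rewrite !inE !andbA.
have : #|nbrs r W v| + #|nbrs r W u| <= #|nbrs r' W u| + #|[set z in U | r u z && r v z]|.
  rewrite -cardsUI leq_add //; apply/subset_leq_card/fintype.subsetP => y; rewrite !inE.
    rewrite /r' /contract nuv eqxx /= => /orP[]/andP[/and3P[yu yv yU] h];
    by rewrite yu yv yU eq_sym yu h ?orbT.
  by case/andP => /andP[/and3P[_ _ ->] ->] /andP[_ ->].
lia.
Qed.

(* Mader's argument: contract an edge with fewer than [k] common neighbours; when
   there is none, every vertex of the link of [x] has at least [k] neighbours in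
   that link. *)
Lemma degsum_of_links (Q : rel V -> {set V} -> Prop) k : 0 < k ->
  (forall r U u v, mod2_planar r -> Q r U -> u \in U -> v \in U -> r u v -> Q (contract r u v) (U :\ v)) ->
  (forall r U x, mod2_planar r -> Q r U -> x \in U -> nbrs r U x != finset.set0 ->
     degsum r (nbrs r U x) < k * #|nbrs r U x|) ->
  forall r U, mod2_planar r -> Q r U -> U != finset.set0 -> degsum r U < 2 * k * #|U|.
Proof.
move=> k0 Qc Ql r U; have [m] := ubnP #|U|; elim: m => // m IH in r U *.
move=> Um rP QU U0; have [rs ri _] := rP.
case: (pickP (fun p : V * V => [&& p.1 \in U, p.2 \in U & r p.1 p.2])) => [[x0 y0]|noE]; last first.
  rewrite /degsum big1 ?muln_gt0 ?k0 ?card_gt0 // => x xU; apply/eqP.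
  rewrite cards_eq0 -finset.subset0; apply/fintype.subsetP => y; rewrite !inE => /andP[yU xy].
  by have := noE (x, y); rewrite /= xU yU xy.
move=> /= /and3P[x0U y0U xy0].
case: (pickP (fun p : V * V => [&& p.1 \in U, p.2 \in U, r p.1 p.2
    & #|[set z in U | r p.1 z && r p.2 z]| < k])) => [[u v] /= /and4P[uU vU uv small]|large].
  (* Removing one vertex costs at most [2 + 2 * (k - 1) = 2 * k]. *)
  have := degsum_contract rs ri uU vU uv.
  have nuv : u != v by apply: contraTneq uv => ->; rewrite ri.
  have U'0 : U :\ v != finset.set0 by apply/set0Pn; exists u; rewrite !inE nuv.
  have cardU : #|U| = #|U :\ v|.+1 by rewrite (cardsD1 v U) vU.
  have Um' : #|U :\ v| < m by rewrite cardU in Um.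
  have := IH _ (U :\ v) Um' (mod2_planar_contract rP uv) (Qc _ _ _ _ rP QU uU vU uv) U'0.
  by rewrite cardU; clear -small; set d := degsum r U; set c := #|_|; set D := degsum _ _; nia.
have := Ql r U x0 rP QU x0U; set X := nbrs r U x0.
have X0 : X != finset.set0 by apply/set0Pn; exists y0; rewrite inE y0U.
move/(_ X0); rewrite ltnNge mulnC -sum_nat_const => /negP[].
apply: leq_sum => y; rewrite inE => /andP[yU xy].
have := large (x0, y); rewrite /= x0U yU xy /= => /negbT; rewrite -leqNgt => /leq_trans; apply.
by apply/subset_leq_card/fintype.subsetP => z; rewrite !inE -andbA.
Qed.

Lemma contract_complete (W : {set V}) r u v : r u v -> v \notin W ->
  {in W &, forall x y, x != y -> r x y} ->
  {in W &, forall x y, x != y -> contract r u v x y}.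
Proof.
move=> uv vW rW x y xW yW xy; rewrite /contract rW // xy.
by rewrite !(memPn vW).
Qed.

(* [T] consists of [t] apices over [U]; links play the role of [U] for [t + 1] apices. *)
Definition apices (t : nat) r (U : {set V}) : Prop := exists T : {set V},
  [/\ #|T| = t, {in T &, forall x y, x != y -> r x y} &
      forall x y, x \in T -> y \in U -> r x y].

Lemma apices_contract t r U u v : irreflexive r -> apices t r U -> u \in U -> v \in U -> r u v ->
  apices t (contract r u v) (U :\ v).
Proof.
move=> ri [T [Tt rT TU]] uU vU uv; exists T.
have vT : v \notin T by apply/negP => vT; have := TU v v vT vU; rewrite ri.
split=> // [|x y xT /setD1P[yv yU]]; first exact: contract_complete.
rewrite /contract (memPn vT) // yv TU //= andbT.
by apply: contraTneq (TU x y xT yU) => ->; rewrite ri.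
Qed.

Lemma apices_link t r U x : symmetric r -> irreflexive r -> apices t r U -> x \in U ->
  apices t.+1 r (nbrs r U x).
Proof.
move=> rs ri [T [Tt rT TU]] xU; exists (x |: T).
have xT : x \notin T by apply/negP => xT; have := TU x x xT xU; rewrite ri.
split=> [|y z|y z]; first by rewrite cardsU1 xT Tt.
  rewrite !inE => /predU1P[->|yT] /predU1P[->|zT]; rewrite ?eqxx // => yz.
  - by rewrite rs TU.
  - by rewrite TU.
  - exact: rT.
by rewrite !inE => /predU1P[->|yT] /andP[zU xz] //; apply: TU.
Qed.

(** An edge inside [U] and the three apices would form a K_5. *)
Lemma degsum_apices3 r U : mod2_planar r -> apices 3 r U -> degsum r U = 0.
Proof.
move=> rP [T [T3 rT TU]]; have [rs ri _] := rP; apply: big1 => x xU; apply/eqP.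
rewrite cards_eq0 -finset.subset0; apply/fintype.subsetP => y; rewrite inE => /andP[yU xy].
have TxU z : z \in U -> z \notin T.
  by move=> zU; apply/negP => zT; have := TU z z zT zU; rewrite ri.
have [s sT us] : exists2 s, size s = 3 & uniq s /\ s =i T.
  by exists (enum T); rewrite -?cardE ?enum_uniq //; split=> // z; rewrite mem_enum.
case: s sT us => [|a [|b [|c [|]]]] // _ [us sT].
have aT : a \in T by rewrite -sT !inE eqxx.
have bT : b \in T by rewrite -sT !inE eqxx orbT.
have cT : c \in T by rewrite -sT !inE eqxx !orbT.
have nxy : x != y by apply: contraTneq xy => ->; rewrite ri.
have U5 : uniq [:: a; b; c; x; y].
  rewrite (_ : [:: a; b; c; x; y] = [:: a; b; c] ++ [:: x; y]) // cat_uniq us /= !sT.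
  by rewrite (negPf (TxU _ xU)) (negPf (TxU _ yU)) !inE nxy.
have rT3 : r a b && r a c && r b c.
  move: us; rewrite /= !inE !negb_or -andbA => /and4P[ab ac bc _].
  by rewrite !rT.
case/andP: rT3 => /andP[ab ac] bc.
by case: (mod2_planar_K5_free rP U5); rewrite ?ab ?ac ?bc ?xy ?(TU _ x) ?(TU _ y).
Qed.

(** Induction on the number of missing apices. Links have one apex more, and their bound serves as
    [k] in [degsum_of_links], which doubles it: the factor is 2, 4, 8 for 2, 1, 0 apices. *)
Lemma degsum_apices t r U : t <= 2 -> mod2_planar r -> apices t r U -> U != finset.set0 ->
  degsum r U < 2 * 2 ^ (2 - t) * #|U|.
Proof.
move=> t2; have [k kt] : exists k, 2 - t = k by exists (2 - t).
rewrite kt; elim: k => [|k IH] in t t2 kt r U *;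
  apply: (@degsum_of_links (apices t)) => [|{}r {}U u v [_ ri _]|{}r {}U x rP tU xU X0];
  rewrite ?expn_gt0 //; try exact: apices_contract; have [rs ri _] := rP.
  rewrite degsum_apices3 ?expn0 ?mul1n ?card_gt0 // (_ : 3 = t.+1); last by lia.
  exact: apices_link.
by rewrite expnS; apply: (IH t.+1) => //; [lia | lia | apply: apices_link].
Qed.

Lemma degsum_mod2_planar r U : mod2_planar r -> degsum r U <= 8 * #|U|.
Proof.
move=> rP; have [->|U0] := eqVneq U finset.set0; first by rewrite /degsum big_set0.
apply/ltnW/(@degsum_apices 0) => //; exists finset.set0.
by split=> [|x y|x y]; rewrite ?cards0 ?inE.
Qed.

(** The strict inequality excludes a 2-regular graph on [U], whose degree sum is exactly
    [2 * #|U|]. *)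
Lemma degsum_two_apices r U a b : mod2_planar r -> r a b ->
  (forall x, x \in U -> r a x && r b x) -> U != finset.set0 -> degsum r U < 2 * #|U|.
Proof.
move=> rP ab abU U0; apply: (@degsum_apices 2) => //; have [rs ri _] := rP.
have nab : a != b by apply: contraTneq ab => ->; rewrite ri.
exists [set a; b]; split=> [|x y|x y]; first by rewrite cards2 nab.
  by rewrite !inE => /orP[]/eqP-> /orP[]/eqP->; rewrite ?eqxx // rs.
by rewrite !inE => /orP[]/eqP-> /abU/andP[].
Qed.

End DegreeSum.

(** * Consequences of K_{3,3}-freeness, and matchings *)

Section Counting.
Variables (V : finType) (r : rel V).
Hypothesis rP : mod2_planar r.
Implicit Types (X Y U L : {set V}).

Let rs : symmetric r. Proof. by case: rP. Qed.
Let ri : irreflexive r. Proof. by case: rP. Qed.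

Lemma sum_nbrsC X Y : \sum_(x in X) #|nbrs r Y x| = \sum_(y in Y) #|nbrs r X y|.
Proof.
under eq_bigr do rewrite nbrs_sum; rewrite exchange_big /=.
by apply: eq_bigr => y _; rewrite nbrs_sum; apply: eq_bigr => x _; rewrite rs.
Qed.

Lemma sum_nbrs_le X Y U : X \subset U -> Y \subset U ->
  \sum_(x in X) #|nbrs r Y x| <= 8 * #|U|.
Proof.
move=> XU YU; apply: leq_trans (degsum_mod2_planar U rP).
rewrite /degsum big_mkcond [leqRHS]big_mkcond; apply: leq_sum => x _; case: ifP => // xX.
rewrite (fintype.subsetP XU) //; apply/subset_leq_card/fintype.subsetP => y.
by rewrite !inE => /andP[/(fintype.subsetP YU) -> ->].
Qed.

Lemma sum_nbrs_leU X Y : \sum_(x in X) #|nbrs r Y x| <= 8 * (#|X| + #|Y|).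
Proof.
apply: leq_trans (sum_nbrs_le (finset.subsetUl X Y) (finset.subsetUr X Y)) _.
by rewrite leq_mul2l cardsU leq_subr.
Qed.

(** Three neighbours of [w] in [Y] would complete a K_{3,3}. *)
Lemma nbrs3_le u v w Y : uniq [:: u; v; w] ->
  {in Y, forall y, r u y && r v y} -> #|nbrs r Y w| <= 2.
Proof.
move=> U uvY; rewrite leqNgt; apply/negP => /card_gt2P[a [b [c [[]]]]].
rewrite !inE => /andP[aY wa] /andP[bY wb] /andP[cY wc] [ab bc ca].
have [[/andP[ua va] /andP[ub vb]] /andP[uc vc]] := (uvY a aY, uvY b bY, uvY c cY).
apply: (mod2_planar_K33_free rP (a := u) (b := v) (c := w) (d := a) (e := b) (f := c)); rewrite ?ua ?ub ?uc ?va ?vb ?vc ?wa ?wb ?wc //.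
have ne p q : r p q -> (q == p) = false.
  by move=> pq; apply/negbTE; apply: contraTneq pq => ->; rewrite ri.
rewrite (cat_uniq [:: u; v; w] [:: a; b; c]) U /= !inE !negb_or ab bc [a == c]eq_sym ca /= andbT.
by rewrite (ne _ _ ua) (ne _ _ va) (ne _ _ wa) (ne _ _ ub) (ne _ _ vb) (ne _ _ wb) (ne _ _ uc) (ne _ _ vc) (ne _ _ wc).
Qed.

(* Bonferroni's inequality *)
Lemma sum_card_le (F : V -> {set V}) L k :
  {in L &, forall x y, x != y -> #|F x :&: F y| <= k} ->
  \sum_(x in L) #|F x| <= #|\bigcup_(x in L) F x| + k * #|L| ^ 2.
Proof.
have [m] := ubnP #|L|; elim: m => // m IH in L *; rewrite ltnS => Lm FL.
have [->|[x xL]] := finset.set_0Vmem L; first by rewrite !big_set0.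
rewrite (big_setD1 x) //= [\bigcup_(_ in _) _](big_setD1 x) //=; set L' := L :\ x.
have cL : #|L| = #|L'|.+1 by rewrite (cardsD1 x) xL.
have := IH L' _ _; rewrite -ltnS -cL => /(_ Lm) IH'.
have {}IH' := IH' _; have /IH' {IH'} : {in L' &, forall y z, y != z -> #|F y :&: F z| <= k}.
  by move=> y z /setD1P[_ yL] /setD1P[_ zL]; apply: FL.
set U' := \bigcup_(_ in L') _.
have : #|F x :&: U'| <= k * #|L'|.
  rewrite /U' big_distrr /= mulnC -sum_nat_const.
  apply: (@leq_trans (\sum_(i in L') #|F x :&: F i|)).
    by elim/big_rec2: _ => [|i a b _ ab]; rewrite ?cards0 //; apply: leq_trans (leq_card_setU _ _) _; rewrite leq_add2l.
  by apply: leq_sum => i /setD1P[ix iL]; apply: FL => //; rewrite eq_sym.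
have := cardsUI (F x) U'; rewrite cL; clear; nia.
Qed.

(** Inside the neighbourhood of [v], those of two members of [L] share at most two vertices by
    [nbrs3_le]; apply Bonferroni's inequality. *)
Lemma sum_common_nbrs_le L v : v \notin L ->
  \sum_(z in L) #|nbrs r (nbrs r finset.setT v) z| <= #|nbrs r finset.setT v| + 2 * #|L| ^ 2.
Proof.
move=> vL; set N := nbrs r finset.setT v.
apply: leq_trans (sum_card_le (F := nbrs r N) (k := 2) _) _ => [x y xL yL xy|].
  apply: leq_trans (nbrs3_le (u := v) (v := x) (w := y) (Y := nbrs r N x) _ _).
  - by apply/subset_leq_card/fintype.subsetP => z; rewrite !inE => /andP[/andP[-> ->] /andP[_ ->]].
  - by rewrite /= !inE negb_or xy !andbT; apply/andP; split; [move: xL|move: yL]; apply: contraTneq => <-.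
  - by move=> z; rewrite !inE => /andP[/= -> ->].
by rewrite leq_add2r; apply/subset_leq_card/finset.bigcupsP => z _; apply/fintype.subsetP => y; rewrite inE => /andP[].
Qed.

(** Greedy choice: as degrees are at most 2, deleting both ends of an edge lowers the degree sum by
    at most 8. *)
Lemma matching_of_degsum p U : {in U, forall x, #|nbrs r U x| <= 2} -> 8 * p <= degsum r U ->
  exists f : 'I_p * bool -> V, [/\ injective f, forall e, f e \in U & forall i, r (f (i, false)) (f (i, true))].
Proof.
elim: p => [|p IH] in U *.
  move=> _ _; have no (i : 'I_0) : False by case: i.
  by exists (fun e => False_rect V (no e.1)); split=> [[i]|[i]|i]; case: (no i).
move=> U2 dU.
have [x /andP[xU x0]] : exists x, (x \in U) && (nbrs r U x != finset.set0).
  apply/existsP; apply: contraTT dU; rewrite negb_exists -ltnNge => /forallP none.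
  rewrite /degsum big1 // => x xU; have := none x; rewrite xU negbK => /eqP ->.
  by rewrite cards0.
have /set0Pn[y] := x0; rewrite inE => /andP[yU xy].
have nxy : x != y by apply: contraTneq xy => ->; rewrite ri.
pose U' := U :\ x :\ y.
have [||f [finj fU fr]] := IH U'.
- move=> z /setD1P[_ /setD1P[_ zU]]; apply: leq_trans (U2 z zU).
  by apply/subset_leq_card/fintype.subsetP => t; rewrite !inE => /andP[/and3P[_ _ ->] ->].
- have yU1 : y \in U :\ x by rewrite !inE eq_sym nxy.
  move: dU; rewrite (degsumD1 rs ri xU) (degsumD1 rs ri yU1) -/U'.
  have := leq_trans (subset_leq_card (_ : nbrs r (U :\ x) x \subset nbrs r U x)) (U2 x xU).
  have := leq_trans (subset_leq_card (_ : nbrs r U' y \subset nbrs r U y)) (U2 y yU).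
  move=> /(_ _)h1 /(_ _)h2; have {}h1 : #|nbrs r U' y| <= 2.
    by apply: h1; apply/fintype.subsetP => t; rewrite !inE => /andP[/and3P[_ _ ->] ->].
  have {}h2 : #|nbrs r (U :\ x) x| <= 2.
    by apply: h2; apply/fintype.subsetP => t; rewrite !inE => /andP[/andP[_ ->] ->].
  lia.
have fx e : f e != x by have := fU e; rewrite !inE => /and3P[].
have fy e : f e != y by have := fU e; rewrite !inE => /and3P[].
exists (fun e => if unlift ord0 e.1 is Some i then f (i, e.2) else if e.2 then y else x).
split=> [[i a] [j b] /=|[i a] /=|i /=].
- case: unliftP => [i' ->|->]; case: unliftP => [j' ->|->] /=.
  + by move=> /finj[-> ->].
  + by case: b => /eqP; rewrite ?(negPf (fx _)) ?(negPf (fy _)).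
  + by case: a => /esym/eqP; rewrite ?(negPf (fx _)) ?(negPf (fy _)).
  + by case: a b => [] [] // /eqP; rewrite ?(negPf nxy) // eq_sym (negPf nxy).
- case: unliftP => [i' _|_]; last by case: a.
  by have := fU (i', a); rewrite !inE => /and3P[].
- by case: unliftP.
Qed.
End Counting.

Local Open Scope ring_scope.

(** * The extremal eigenvector *)

Section Estimate.
Variables (R : realType) (V : finType) (r : rel V) (x : V -> R) (rho eps : R) (u : V).
Hypotheses (rP : mod2_planar r)
  (eig : forall v, rho * x v = \sum_y (r v y)%:R * x y)
  (x01 : forall v, 0 <= x v <= 1) (xu : x u = 1)
  (eps0 : 0 < eps) (eps1 : 64 * (64 * eps) <= 1)
  (rho0 : 0 < rho) (rho2 : 2 * #|V|%:R <= rho ^+ 2).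
Local Notation n := (#|V|%:R : R).
Local Notation N v := (nbrs r [set: V]%SET v).
Implicit Types (v w y z : V) (X Y L : {set V}).

Let rs : symmetric r. Proof. by case: rP. Qed.
Let ri : irreflexive r. Proof. by case: rP. Qed.
Let x_ge0 v : 0 <= x v. Proof. by case/andP: (x01 v). Qed.
Let x_le1 v : x v <= 1. Proof. by case/andP: (x01 v). Qed.
Let n_gt0 : 0 < n. Proof. by rewrite ltr0n; apply/card_gt0P; exists u. Qed.

Lemma nbrsR X v : #|nbrs r X v|%:R = \sum_(y in X) (r v y)%:R :> R.
Proof. by rewrite nbrs_sum natr_sum. Qed.

Lemma eig_le v : rho * x v <= #|N v|%:R.
Proof.
rewrite eig nbrsR [leRHS]big_mkcond; apply: ler_sum => y _; rewrite inE.
by rewrite ler_piMr ?ler0n.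
Qed.

Lemma card_le_n X : #|X|%:R <= n.
Proof. by rewrite ler_nat max_card. Qed.

Lemma sum_nbrs_n X Y : (\sum_(v in X) #|nbrs r Y v|%:R : R) <= 8 * n.
Proof.
rewrite -natr_sum -[8 * n]natrM ler_nat -cardsT.
exact: (sum_nbrs_le rP (finset.subsetT X) (finset.subsetT Y)).
Qed.

(** An entry at least [d] forces degree at least [rho * d], while all degrees add up to at most
    [8 * n]. *)
Lemma card_large d : 0 <= d -> rho * d * #|[set v | d <= x v]|%:R <= 8 * n.
Proof.
move=> d0; apply: le_trans (sum_nbrs_n [set v | d <= x v]%SET [set: V]%SET).
rewrite mulr_natr -sumr_const; apply: ler_sum => v; rewrite inE => dv.
by apply: le_trans (eig_le v); rewrite ler_pM2l.
Qed.

(** Walks of length 2 from [v], grouped by their end [z]; ends outside [L] have weight at most [d],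
    and there are at most [8 * n] such walks. *)
Lemma walk2 v L d : 0 <= d -> (forall z, z \notin L -> x z <= d) ->
  rho ^+ 2 * x v <= \sum_(z in L) #|nbrs r (N v) z|%:R * x z + 8 * d * n.
Proof.
move=> d0 xd.
have -> : rho ^+ 2 * x v = \sum_z #|nbrs r (N v) z|%:R * x z.
  rewrite expr2 -mulrA eig mulr_sumr.
  transitivity (\sum_y \sum_z (r v y)%:R * (r y z)%:R * x z).
    apply: eq_bigr => y _; rewrite mulrCA eig mulr_sumr.
    by apply: eq_bigr => z _; rewrite mulrA.
  rewrite exchange_big; apply: eq_bigr => z _; rewrite -mulr_suml; congr (_ * _).
  rewrite nbrsR [RHS]big_mkcond; apply: eq_bigr => y _; rewrite !inE /= [r z y]rs.
  by case: (r v y); rewrite ?mul1r ?mul0r.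
rewrite (bigID (mem L)) lerD2l /=.
have -> : 8 * d * n = 8 * n * d by ring.
have dn := ler_wpM2r d0 (sum_nbrs_n (~: L)%SET (N v)); apply: le_trans dn.
rewrite mulr_suml; under [leRHS]eq_bigl do rewrite inE.
by apply: ler_sum => z zL; rewrite ler_wpM2l ?ler0n ?xd.
Qed.

Lemma degree_large v : 1024 <= eps ^+ 2 * rho -> eps <= x v -> eps * n <= 16 * #|N v|%:R.
Proof.
(* With threshold [eps / 8], small ends contribute at most [eps * n], half of the lower bound
   [2 * n * eps] for [rho ^+ 2 * x v]. The large ends are few: 1024 is 16 * 64, where [card_large]
   supplies the 64. *)
move=> rho_large xv; pose d := eps / 8; have d0 : 0 < d by rewrite divr_gt0.
pose L := [set z | d <= x z]%SET.
have L_le : 16 * #|L|%:R <= eps * n.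
  have := card_large (ltW d0); rewrite -/L /d => h.
  have er : 0 < eps * rho by rewrite mulr_gt0.
  rewrite -(ler_pM2l er); have := ler_wpM2r (ltW n_gt0) rho_large; lra.
have h := walk2 v (L := L) (ltW d0).
have {h} : rho ^+ 2 * x v <= \sum_(z in L) #|nbrs r (N v) z|%:R * x z + 8 * d * n.
  by apply: h => z; rewrite inE -ltNge => /ltW.
have : \sum_(z in L) #|nbrs r (N v) z|%:R * x z <= 8 * (#|L|%:R + #|N v|%:R) :> R.
  rewrite -natrD -natrM; apply: le_trans (_ : (\sum_(z in L) #|nbrs r (N v) z|)%:R <= _); last first.
    by rewrite ler_nat sum_nbrs_leU.
  by rewrite natr_sum; apply: ler_sum => z _; rewrite ler_piMr ?ler0n.
have : 2 * n * eps <= rho ^+ 2 * x v.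
  by apply: ler_pM => //; exact: ltW.
have -> : 8 * d * n = eps * n by rewrite /d; field.
lra.
Qed.

(** Sharpens [card_large]: by [degree_large] each of these vertices has degree linear in [n], so
    their number is bounded independently of [n]. *)
Lemma card_large_const : 1024 <= eps ^+ 2 * rho -> eps * #|[set v | eps <= x v]|%:R <= 128 :> R.
Proof.
move=> rho_large; set L := finset _.
have : \sum_(v in L) (eps * n) <= 16 * (8 * n).
  have := sum_nbrs_n L [set: V]%SET; rewrite -(ler_pM2l (_ : 0 < 16)) // mulr_sumr.
  by apply: le_trans; apply: ler_sum => v; rewrite inE; apply: degree_large.
rewrite sumr_const -mulr_natr => h; rewrite -(ler_pM2r n_gt0); lra.
Qed.

Hypotheses (rho_large : 1024 <= eps ^+ 2 * rho) (n_large : 128 * (128 * 2) < eps ^+ 3 * n).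
Local Notation L := [set v | eps <= x v]%SET.

(** Makes the Bonferroni error in [sum_common_nbrs_le] at most [eps * n]. *)
Lemma card_large_sqr : 2 * #|L|%:R ^+ 2 <= eps * n.
Proof.
have k := card_large_const rho_large; set m : R := #|L|%:R in k *.
have m0 : 0 <= m by rewrite ler0n.
have em : 0 <= eps * m by rewrite mulr_ge0 // ltW.
have sq : (eps * m) ^+ 2 <= 128 * 128 by rewrite expr2 ler_pM.
have e2 : 0 < eps ^+ 2 by rewrite exprn_gt0.
rewrite -(ler_pM2l e2).
have -> : eps ^+ 2 * (2 * m ^+ 2) = 2 * (eps * m) ^+ 2 by ring.
have -> : eps ^+ 2 * (eps * n) = eps ^+ 3 * n by ring.
apply: le_trans (ltW n_large); rewrite [128 * (128 * 2)]mulrA [leRHS]mulrC.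
by rewrite ler_pM2l.
Qed.

Lemma walk2_large v : eps <= x v ->
  rho ^+ 2 * x v <= #|N v|%:R * x v + \sum_(z in (L :\ v)%SET) #|nbrs r (N v) z|%:R * x z + 8 * eps * n.
Proof.
move=> xv; have h := walk2 v (L := L) (ltW eps0); apply: le_trans (h _) _.
  by move=> z; rewrite inE -ltNge => /ltW.
have vL : v \in L by rewrite inE.
rewrite (big_setD1 v vL) /= lerD2r lerD2r ler_wpM2r // ler_nat.
by apply/subset_leq_card/fintype.subsetP => y; rewrite inE => /andP[].
Qed.

Lemma sum_common v : \sum_(z in (L :\ v)%SET) #|nbrs r (N v) z|%:R <= #|N v|%:R + eps * n.
Proof.
have vL : v \notin (L :\ v)%SET by rewrite !inE eqxx.
rewrite -natr_sum; apply: le_trans (_ : (#|N v| + 2 * #|L| ^ 2)%:R <= _).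
  rewrite ler_nat; apply: leq_trans (sum_common_nbrs_le rP vL) _.
  by rewrite leq_add2l leq_mul2l leq_exp2r //= subset_leq_card // finset.subD1set.
by rewrite natrD natrM natrX lerD2l card_large_sqr.
Qed.

(** Of the walks from [v], those returning weigh at most [#|N v|], those to other large vertices at
    most [#|N v| + eps * n], the rest [8 * eps * n]. *)
Lemma degree_lower v : eps <= x v -> 2 * n * x v <= 2 * #|N v|%:R + 9 * eps * n.
Proof.
move=> xv; have h1 := walk2_large xv; have h2 := sum_common v.
have h3 : 2 * n * x v <= rho ^+ 2 * x v by rewrite ler_wpM2r.
have h4 : \sum_(z in (L :\ v)%SET) #|nbrs r (N v) z|%:R * x z <= \sum_(z in (L :\ v)%SET) #|nbrs r (N v) z|%:R.
  by apply: ler_sum => z _; rewrite ler_piMr ?ler0n.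
have h5 : #|N v|%:R * x v <= #|N v|%:R by rewrite ler_piMr ?ler0n.
lra.
Qed.

Lemma rho_upper : rho ^+ 2 <= 2 * n + 9 * eps * n.
Proof.
have xv : eps <= x u by rewrite xu; have := eps1; have := eps0; lra.
have h1 := walk2_large xv; have h2 := sum_common u.
have h4 : \sum_(z in (L :\ u)%SET) #|nbrs r (N u) z|%:R * x z <= \sum_(z in (L :\ u)%SET) #|nbrs r (N u) z|%:R.
  by apply: ler_sum => z _; rewrite ler_piMr ?ler0n.
have h6 := card_le_n (N u); rewrite xu in h1; lra.
Qed.

(** Otherwise the walks from [u] would give [rho ^+ 2 <= n + (n + eps * n) * (1 - 10 * eps) + 8 *
    eps * n < 2 * n]. *)
Lemma second_vertex : exists2 w, w != u & 1 - 10 * eps <= x w.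
Proof.
have xv : eps <= x u by rewrite xu; have := eps1; have := eps0; lra.
case: (pickP (fun w => (w != u) && (1 - 10 * eps <= x w))) => [w /andP[]|no]; first by exists w.
have h1 := walk2_large xv; have h2 := sum_common u; have h6 := card_le_n (N u).
have h4 : \sum_(z in (L :\ u)%SET) #|nbrs r (N u) z|%:R * x z <= (#|N u|%:R + eps * n) * (1 - 10 * eps).
  apply: le_trans (ler_wpM2r _ h2); last by have := eps1; have := eps0; lra.
  rewrite mulr_suml; apply: ler_sum => z; rewrite !inE => /andP[zu _].
  by rewrite ler_wpM2l ?ler0n //; have := no z; rewrite zu /= => /negbT; rewrite -ltNge => /ltW.
have en : 0 < eps * n by rewrite mulr_gt0.
have h7 : (#|N u|%:R + eps * n) * (1 - 10 * eps) <= (n + eps * n) * (1 - 10 * eps).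
  by rewrite ler_wpM2r ?lerD2r //; have := eps1; have := eps0; lra.
have e2n : 0 < eps * (eps * n) by rewrite mulr_gt0.
by rewrite xu in h1; exfalso; have := rho2; lra.
Qed.

(** * The two hubs and their common neighbourhood *)

Section TwoHubs.
Variable w : V.
Hypotheses (wu : w != u) (xw : 1 - 10 * eps <= x w).

(* The hubs are [u] and [w], with common neighbourhood [A]; [B] is the rest. *)
Local Notation A := [set v | r u v && r w v]%SET.
Local Notation B := [set v | [&& v != u, v != w & ~~ (r u v && r w v)]]%SET.

Lemma sum_hubs (F : V -> R) : \sum_v F v = F u + F w + \sum_(v in A) F v + \sum_(v in B) F v.
Proof.
rewrite (bigD1 u) //= (bigD1 w) //= (bigID (fun v => r u v && r w v)) /= !addrA.
congr (_ + _ + _); apply: eq_bigl => v; rewrite !inE.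
  case: eqP => [->|_] /=; first by rewrite ri.
  by case: eqP => [->|] //; rewrite ri andbF.
by rewrite -andbA.
Qed.

Lemma card_hubs : n = 2 + #|A|%:R + #|B|%:R.
Proof.
by have := sum_hubs (fun=> 1); rewrite !sumr_const => ->.
Qed.

(** By [degree_lower] the degrees of [u] and [w] fall short of [n] by at most 4.5 and 14.5 times
    [eps * n]. *)
Lemma card_B : #|B|%:R <= 19 * eps * n.
Proof.
have hu : eps <= x u by rewrite xu; have := eps1; have := eps0; lra.
have hw : eps <= x w by apply: le_trans xw; have := eps1; have := eps0; lra.
have := degree_lower hu; have := degree_lower hw; rewrite xu mulr1.
have : 2 * n * (1 - 10 * eps) <= 2 * n * x w by rewrite ler_pM2l // mulr_gt0.
have : #|N u|%:R + #|N w|%:R <= n + #|A|%:R :> R.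
  rewrite -!natrD ler_nat -cardsUI leq_add ?max_card //.
  by apply/subset_leq_card/fintype.subsetP => v; rewrite !inE.
have := card_hubs; lra.
Qed.

Lemma nbrs_A_le v : v != u -> v != w -> (#|nbrs r A v| <= 2)%N.
Proof.
move=> vu vw; apply: (nbrs3_le rP (u := u) (v := w)); last by move=> y; rewrite inE.
by rewrite /= !inE negb_or ![u == _]eq_sym wu vu eq_sym vw.
Qed.

Lemma degree_hubs v : #|N v|%:R = (r v u)%:R + (r v w)%:R + #|nbrs r A v|%:R + #|nbrs r B v|%:R :> R.
Proof.
rewrite !nbrsR big_mkcond sum_hubs !inE /=; congr (_ + _ + _ + _);
  by apply: eq_bigr => y _; rewrite inE.
Qed.

(** A vertex of [B] has at most one hub and two vertices of [A] as neighbours; the degrees inside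
    [B] add up to at most [8 * #|B|]. *)
Lemma sum_degree_B : \sum_(b in B) #|N b|%:R <= 11 * #|B|%:R :> R.
Proof.
apply: le_trans (_ : \sum_(b in B) (3 + #|nbrs r B b|%:R) <= _); last first.
  have := sum_nbrs_le rP (fintype.subxx B) (fintype.subxx B).
  by rewrite -(ler_nat R) natr_sum natrM big_split /= sumr_const -[3 *+ _]mulr_natr; lra.
apply: ler_sum => b; rewrite inE => /and3P[bu bw nb]; rewrite degree_hubs lerD2r.
rewrite -!natrD ler_nat (@leq_add _ _ 1 2) ?nbrs_A_le //.
by move: nb; rewrite [r b u]rs [r b w]rs; case: (r u b) (r w b) => [] [].
Qed.

(** The neighbours of [v] outside [B] contribute at most 4 to [rho * x v], and [rho] times the sum
    of [x] over [B] is at most [11 * #|B|]. Hence [rho ^+ 2 * x v] is at most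
    [4 * rho + 209 * eps * n], where [4 <= eps * rho] and [2 * n <= rho ^+ 2]. *)
Lemma x_small v : v != u -> v != w -> x v <= 106 * eps.
Proof.
move=> vu vw; have SB := sum_degree_B.
have h1 : rho * \sum_(b in B) x b <= 11 * #|B|%:R.
  by rewrite mulr_sumr; apply: le_trans SB; apply: ler_sum => b _; exact: eig_le.
have h2 : rho * x v <= 4 + \sum_(b in B) x b.
  rewrite eig sum_hubs; apply: lerD.
    have a0 : (r v u)%:R * x u <= 1 by rewrite mulr_ile1 ?ler0n // lern1; case: (r v u).
    have a1 : (r v w)%:R * x w <= 1 by rewrite mulr_ile1 ?ler0n // lern1; case: (r v w).
    have a2 : \sum_(y in A) (r v y)%:R * x y <= 2.
      apply: le_trans (_ : #|nbrs r A v|%:R <= _); last by rewrite (ler_nat _ _ 2) nbrs_A_le.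
      by rewrite nbrsR; apply: ler_sum => y _; rewrite ler_piMr ?ler0n.
    lra.
  by apply: ler_sum => y _; rewrite ler_piMl // lern1; case: (r v y).
have h3 := card_B.
have h4 : rho * (rho * x v) <= 4 * rho + 11 * (19 * eps * n).
  have := ler_wpM2l (ltW rho0) h2; rewrite mulrDr; lra.
have h5 : 4 * rho <= eps * rho ^+ 2.
  have e2 : eps ^+ 2 <= eps by rewrite expr2 ler_piMr ?ltW //; have := eps1; have := eps0; lra.
  have : eps ^+ 2 * rho <= eps * rho by rewrite ler_pM2r.
  move=> h; have h' : 4 <= eps * rho by have := rho_large; lra.
  by rewrite expr2 mulrA ler_pM2r.
have h6 : 2 * (eps * n) <= eps * rho ^+ 2 by have := ler_wpM2l (ltW eps0) rho2; lra.
have r2 : 0 < rho ^+ 2 by rewrite exprn_gt0.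
rewrite -(ler_pM2l r2) expr2 -mulrA; apply: le_trans h4 _.
have er : 0 < eps * rho ^+ 2 by rewrite mulr_gt0.
lra.
Qed.
Lemma sum_nbrs_x X Y : \sum_(v in X) \sum_(y in Y) (r v y)%:R * x y =
  \sum_(y in Y) #|nbrs r X y|%:R * x y.
Proof.
rewrite exchange_big; apply: eq_bigr => y _; rewrite -mulr_suml nbrsR; congr (_ * _).
by apply: eq_bigr => v _; rewrite rs.
Qed.

(* Pair the eigenvalue equation with the vector equal to [t] on the hubs and to
   [1] elsewhere, the eigenvector of the double wheel for [t * 2 + 2]. *)
Lemma hubs_inequality t : 0 <= t -> t * (t * 2 + 2) = n - 2 ->
  (rho - (t * 2 + 2)) * (t * (1 + x w) + \sum_(a in A) x a + \sum_(b in B) x b) <=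
  t * (r u w)%:R * (1 + x w) + \sum_(a in A) (#|nbrs r A a|%:R - 2) * x a - #|B|%:R / 2.
Proof.
move=> t0 tE; set SA := \sum_(a in A) x a; set SB := \sum_(b in B) x b.
have AP v : v \in A -> r u v && r w v by rewrite inE.
have E1 : rho = (r u w)%:R * x w + SA + \sum_(b in B) (r u b)%:R * x b.
  transitivity (rho * x u); first by rewrite xu mulr1.
  rewrite eig sum_hubs ri mul0r add0r /SA; congr (_ + _ + _).
  by apply: eq_bigr => a /AP/andP[-> _]; rewrite mul1r.
have E2 : rho * x w = (r u w)%:R + SA + \sum_(b in B) (r w b)%:R * x b.
  rewrite eig sum_hubs ri mul0r addr0 rs xu mulr1 /SA; congr (_ + _ + _).
  by apply: eq_bigr => a /AP/andP[_ ->]; rewrite mul1r.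
have expand X : \sum_(v in X) rho * x v = \sum_(v in X) (r v u)%:R + (\sum_(v in X) (r v w)%:R) * x w +
    \sum_(a in A) #|nbrs r X a|%:R * x a + \sum_(b in B) #|nbrs r X b|%:R * x b.
  under eq_bigr do rewrite eig sum_hubs xu mulr1.
  by rewrite !big_split /= !sum_nbrs_x mulr_suml.
have E3 : \sum_(v in A) rho * x v = #|A|%:R * (1 + x w) +
    \sum_(a in A) #|nbrs r A a|%:R * x a + \sum_(b in B) #|nbrs r A b|%:R * x b.
  rewrite expand mulrDr mulr1; congr (_ + _ * _ + _ + _); rewrite -sumr_const;
  by apply: eq_bigr => a /AP/andP[ua wa]; rewrite rs ?ua ?wa.
have E4 := expand B; set bu := \sum_(v in B) (r v u)%:R in E4; set bw := \sum_(v in B) (r v w)%:R in E4.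
have bub : bu + bw <= #|B|%:R.
  rewrite -big_split -sumr_const; apply: ler_sum => b; rewrite inE => /and3P[_ _] /=.
  by rewrite -natrD lern1 [r b u]rs [r b w]rs; case: (r u b) (r w b) => [] [].
have bu0 : 0 <= bu by apply: sumr_ge0 => *; rewrite ler0n.
have bw0 : 0 <= bw by apply: sumr_ge0 => *; rewrite ler0n.
have T4 : \sum_(b in B) (r u b)%:R * x b + \sum_(b in B) (r w b)%:R * x b <= SB.
  rewrite -big_split; apply: ler_sum => b; rewrite inE => /and3P[_ _ nb] /=.
  rewrite -mulrDl ler_piMl // -natrD lern1; move: nb.
  by case: (r u b) (r w b) => [] [].
(* Entries off the hubs are at most [m], so the non-hub edges meeting [B] contribute at most
   [12 * m * #|B|], far less than the loss of about [#|B|] from missing hub edges. *)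
pose m := 106 * eps; have m0 : 0 <= m by rewrite mulr_ge0 // ltW.
have xB X Y k : (forall y, y \in Y -> (y != u) && (y != w)) -> \sum_(y in Y) #|nbrs r X y|%:R <= k * #|B|%:R ->
    \sum_(y in Y) #|nbrs r X y|%:R * x y <= m * (k * #|B|%:R).
  move=> Yuw /(ler_wpM2l m0); apply: le_trans; rewrite mulr_sumr; apply: ler_sum => y /Yuw/andP[yu yw].
  by rewrite mulrC ler_wpM2r ?ler0n // x_small.
have Auw y : y \in A -> (y != u) && (y != w).
  by move=> /AP/andP[uy wy]; apply/andP; split; [apply: contraTneq uy|apply: contraTneq wy] => ->; rewrite ri.
have Buw y : y \in B -> (y != u) && (y != w) by rewrite inE => /and3P[-> ->].
have AB2 : \sum_(b in B) #|nbrs r A b|%:R <= 2 * #|B|%:R :> R.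
  rewrite mulr_natr -sumr_const; apply: ler_sum => b /Buw/andP[bu' bw'].
  by rewrite (ler_nat _ _ 2) nbrs_A_le.
have T1 : \sum_(a in A) #|nbrs r B a|%:R * x a <= m * (2 * #|B|%:R).
  by apply: xB => //; rewrite -natr_sum (sum_nbrsC rP) natr_sum.
have T2 : \sum_(b in B) #|nbrs r A b|%:R * x b <= m * (2 * #|B|%:R) by apply: xB.
have T3 : \sum_(b in B) #|nbrs r B b|%:R * x b <= m * (8 * #|B|%:R).
  by apply: xB => //; rewrite -natr_sum -natrM ler_nat (sum_nbrs_le rP).
have nE := card_hubs.
have -> : \sum_(a in A) (#|nbrs r A a|%:R - 2) * x a = \sum_(a in A) #|nbrs r A a|%:R * x a - 2 * SA.
  by under eq_bigr do rewrite mulrBl; rewrite sumrB mulr_sumr.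
rewrite -!mulr_sumr -/SA -/SB in E3 E4.
have C1 := ler_wpM2l t0 T4.
have bwB : 0 <= #|B|%:R - bw by lra.
have C2 := ler_wpM2l bwB xw.
have C3 : 64 * (64 * (eps * #|B|%:R)) <= #|B|%:R by have := ler_wpM2r (ler0n R #|B|) eps1; lra.
have C4 : 0 <= eps * bw by rewrite mulr_ge0 // ltW.
have SB0 : 0 <= SB by apply: sumr_ge0.
have C5 : 0 <= t * SB by rewrite mulr_ge0.
have C6 : 0 <= eps * #|B|%:R by rewrite mulr_ge0 ?ler0n // ltW.
have F1 := congr1 ( *%R t) E1; have F2 := congr1 ( *%R t) E2.
have F3 := congr1 (fun c : R => c * (1 + x w)) tE; rewrite /= nE in F3.
move: E3 E4 T1 T2 T3 C1 C2 F1 F2 F3; rewrite /m.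
set b := #|B|%:R in C3 C6 bub bwB *; set Su := \sum_(b in B) _; set Sw := \sum_(b in B) _.
lra.
Qed.

(** In [hubs_inequality] the left side is nonnegative and both remaining terms on the right are
    nonpositive. So all vanish: [B] is empty, and since [x] is positive on [A], all degrees inside
    [A] are 2. *)
Lemma hubs_nonadjacent t : 0 <= t -> t * (t * 2 + 2) = n - 2 -> t * 2 + 2 <= rho -> ~~ r u w ->
  (forall v, v != u -> v != w -> r u v && r w v) /\
  (forall v, v != u -> v != w -> #|nbrs r [set v | (v != u) && (v != w)]%SET v| = 2%N).
Proof.
move=> t0 tE t_rho uw; have := hubs_inequality t0 tE; rewrite (negPf uw) mulr0 mul0r add0r => H.
have Auw a : a \in A -> (a != u) && (a != w).
  by rewrite inE => /andP[uy wy]; apply/andP; split; [apply: contraTneq uy|apply: contraTneq wy] => ->; rewrite ri.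
have P0 : 0 <= (rho - (t * 2 + 2)) * (t * (1 + x w) + \sum_(a in A) x a + \sum_(b in B) x b).
  by rewrite mulr_ge0 ?subr_ge0 // !addr_ge0 ?mulr_ge0 ?addr_ge0 ?sumr_ge0.
have SA0 a : a \in A -> 0 <= (2 - #|nbrs r A a|%:R) * x a.
  by move=> /Auw/andP[au aw]; rewrite mulr_ge0 // subr_ge0 (ler_nat _ _ 2) nbrs_A_le.
have SAE : \sum_(a in A) (#|nbrs r A a|%:R - 2) * x a = - \sum_(a in A) (2 - #|nbrs r A a|%:R) * x a.
  by rewrite -sumrN; apply: eq_bigr => a _; rewrite -mulNr opprB.
have SA_ge0 : 0 <= \sum_(a in A) (2 - #|nbrs r A a|%:R) * x a by apply: sumr_ge0.
have B0 : 0 <= #|B|%:R :> R by rewrite ler0n.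
have {}B0 : B = finset.set0.
  by apply/eqP; rewrite -cards_eq0 -(eqr_nat R); apply/eqP; rewrite SAE in H; lra.
have allA v : v != u -> v != w -> r u v && r w v.
  move=> vu vw; have vB : v \notin B by rewrite B0 inE.
  by move: vB; rewrite inE vu vw /= negbK.
split=> // v vu vw.
have -> : [set v | (v != u) && (v != w)]%SET = A.
  by apply/setP => y; rewrite [in RHS]inE; apply/idP/idP => [|yA]; [rewrite inE => /andP[]; apply: allA|rewrite inE Auw ?inE].
have vA : v \in A by rewrite inE allA.
have : \sum_(a in A) (2 - #|nbrs r A a|%:R) * x a == 0.
  have bz : #|B|%:R = 0 :> R by rewrite B0 cards0.
  by rewrite eq_le SA_ge0 andbT; rewrite SAE in H; lra.
rewrite psumr_eq0 // => /allP/(_ v); rewrite mem_index_enum vA /= mulf_eq0 => /(_ isT).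
have xv : 0 < x v.
  rewrite -(pmulr_rgt0 _ rho0) eig sum_hubs [r v u]rs; case/andP: (allA v vu vw) => -> _; rewrite xu mul1r.
  by rewrite -!addrA ltr_wpDr // !addr_ge0 ?sumr_ge0 ?mulr_ge0 ?ler0n // => *; rewrite mulr_ge0 ?ler0n.
by rewrite (gt_eqF xv) orbF subr_eq0 (eqr_nat _ 2) => /eqP.
Qed.

(** The inequality bounds the sum [SA] of [x] over [A] by [2 * SA <= 2 * t + 8 * p], hence by
    [0.9 * rho]. But [rho * SA] is at least [(2 - 10 * eps) * #|A|], which is nearly [2 * n] and so
    nearly [rho ^+ 2] by [rho_upper]. *)
Lemma hubs_adjacent t p : 0 <= t -> t * (t * 2 + 2) = n - 2 -> t * 2 + 2 <= rho -> r u w ->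
  (degsum r A <= 8 * p)%N -> 10 * p%:R < rho -> False.
Proof.
move=> t0 tE t_rho uw dA p_rho; have := hubs_inequality t0 tE; rewrite uw mulr1 => H.
have P0 : 0 <= (rho - (t * 2 + 2)) * (t * (1 + x w) + \sum_(a in A) x a + \sum_(b in B) x b).
  by rewrite mulr_ge0 ?subr_ge0 // !addr_ge0 ?mulr_ge0 ?addr_ge0 ?sumr_ge0.
set SA := \sum_(a in A) x a in P0 H.
have S1 : \sum_(a in A) (#|nbrs r A a|%:R - 2) * x a <= 8 * p%:R - 2 * SA.
  under eq_bigr do rewrite mulrBl.
  rewrite sumrB -mulr_sumr lerD2r -natrM; apply: le_trans (_ : (degsum r A)%:R <= _); last by rewrite ler_nat.
  by rewrite natr_sum; apply: ler_sum => a _; rewrite ler_piMr ?ler0n.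
have S2 : #|A|%:R * (2 - 10 * eps) <= rho * SA.
  rewrite mulr_natl -sumr_const mulr_sumr; apply: ler_sum => a; rewrite inE => /andP[ua wa].
  rewrite eig sum_hubs [r a u]rs [r a w]rs ua wa xu !mul1r -[leRHS]addrA.
  have := xw; set S := _ + \sum_(_ in B) _; have : 0 <= S; last by lra.
  by rewrite /S !addr_ge0 ?sumr_ge0 // => *; rewrite mulr_ge0 ?ler0n.
have B0 : 0 <= #|B|%:R :> R by rewrite ler0n.
have nE := card_hubs; have bB := card_B; have ru := rho_upper.
have en : 64 * (64 * (eps * n)) <= n by have := ler_wpM2r (ltW n_gt0) eps1; lra.
have txw : t * (1 + x w) <= t * 2 by rewrite ler_wpM2l //; have := x_le1 w; lra.
have SA_rho : 10 * SA <= 9 * rho by lra.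
have n100 : 100 <= n.
  have e3 : eps ^+ 3 <= 1 by rewrite exprn_ile1 // ?ltW //; have := eps1; have := eps0; lra.
  have := ler_wpM2r (ltW n_gt0) e3; have := n_large; lra.
have S3 := ler_wpM2l (ltW rho0) SA_rho.
have S4 := ler_wpM2l (ltW eps0) (card_le_n A).
rewrite expr2 in ru; lra.
Qed.
End TwoHubs.
End Estimate.

Local Open Scope classical_set_scope.
Local Open Scope ring_scope.

(** * Plane drawings are mod 2 planar *)

Lemma addb_telescope (f : nat -> bool) n :
  \big[addb/false]_(i < n) (f i (+) f i.+1) = f 0%N (+) f n.
Proof.
elim: n => [|n IH]; first by rewrite big_ord0 addbb.
by rewrite big_ord_recr /= IH addbA -[X in X (+) _]addbA addbb addbF.
Qed.

(** A discrete Stokes theorem: if the sum around every cell is zero, so is the sum around the whole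
    grid. *)
Lemma addb_grid (hor ver : nat -> nat -> bool) N :
  (forall i j, (i < N)%N -> (j < N)%N ->
     hor i j (+) hor i j.+1 = ver i j (+) ver i.+1 j) ->
  \big[addb/false]_(i < N) hor i 0%N (+) \big[addb/false]_(i < N) hor i N =
  \big[addb/false]_(j < N) ver 0%N j (+) \big[addb/false]_(j < N) ver N j.
Proof.
move=> sq; pose row j := \big[addb/false]_(i < N) hor i j.
rewrite -[LHS](addb_telescope row) -big_split; apply: eq_bigr => j _ /=.
rewrite /row -big_split /= -(addb_telescope (fun i => ver i j)).
by apply: eq_bigr => i _; rewrite sq.
Qed.

Section Crossing.
Variable R : realType.
Implicit Types p q : R * R.

Definition upper p := (0 < p.2) || (p.2 == 0) && (0 < p.1).

(* When [p] and [q] lie in a common open half plane bounded by an axis, this is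
   the parity of the crossings of the segment [p q] with the positive x-axis. *)
Definition crossing p q := (upper p (+) upper q) && (0 < p.1).

(** These four half planes cover the plane without the origin, and a segment inside one of them
    avoids the origin. *)
Definition in_half (i : bool * bool) p := 0 < (-1) ^+ i.2 * (if i.1 then p.1 else p.2).

Lemma upperN p : p != 0 -> upper (- p) = ~~ upper p.
Proof.
case: p => a b; rewrite /upper /= -[0]/(0, 0) xpair_eqE /= !oppr_gt0 oppr_eq0.
by case: (ltgtP b 0); case: (ltgtP a 0).
Qed.

Lemma in_half_neq0 i p : in_half i p -> p != 0.
Proof. by apply: contraTneq => ->; rewrite /in_half; case: ifP; rewrite mulr0 ltxx. Qed.

(** Only the right half plane [(true, false)] allows a crossing, and there it is a difference of
    [upper] values; hence the sum around a square vanishes in [crossing_square]. *)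
Lemma crossing_half i p q : in_half i p -> in_half i q ->
  crossing p q = (upper p (+) upper q) && (i == (true, false)).
Proof.
case: p q => a b [c d]; case: i => [] [] [];
rewrite /in_half /crossing /upper /= ?expr1 ?expr0 ?mulN1r ?mul1r ?oppr_gt0;
by case: (ltgtP a 0); case: (ltgtP b 0); case: (ltgtP c 0); case: (ltgtP d 0).
Qed.

(** The opposite segment crosses the positive x-axis where the given one crosses the negative
    x-axis. *)
Lemma crossingN i p q : in_half i p -> in_half i q ->
  crossing p q (+) crossing (- p) (- q) = upper p (+) upper q.
Proof.
move=> hp hq; rewrite /crossing !upperN ?(in_half_neq0 hp) ?(in_half_neq0 hq) //.
rewrite addNb addbN negbK /= oppr_gt0 -andb_addr.
case: p q hp hq => a b [c d]; case: i => [] [] [];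
rewrite /in_half /crossing /upper /= ?expr1 ?expr0 ?mulN1r ?mul1r ?oppr_gt0;
by case: (ltgtP a 0); case: (ltgtP b 0); case: (ltgtP c 0); case: (ltgtP d 0).
Qed.

Lemma crossing_square i p q p' q' :
  in_half i p -> in_half i q -> in_half i p' -> in_half i q' ->
  crossing p q (+) crossing p' q' = crossing p p' (+) crossing q q'.
Proof.
move=> hp hq hp' hq'; do 4!rewrite (@crossing_half i) //.
by rewrite -!andb_addl (AC (2*2) ((1*3)*(2*4))).
Qed.

Definition winding N (f : nat -> R * R) := \big[addb/false]_(k < N) crossing (f k) (f k.+1).

(** The crossing parity of [f i - g j] around the boundary of the grid is zero. On two sides the
    difference is reversed to [g j - f i], which by [crossingN] adds the [upper] values of the
    corners. *)
Lemma winding_grid (f g : nat -> R * R) N :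
  (forall i j, (i < N)%N -> (j < N)%N -> exists k,
     [/\ in_half k (f i - g j), in_half k (f i.+1 - g j),
         in_half k (f i - g j.+1) & in_half k (f i.+1 - g j.+1)]) ->
  (0 < N)%N ->
  winding N (fun i => f i - g 0%N) (+) winding N (fun i => f i - g N) (+)
  winding N (fun j => g j - f 0%N) (+) winding N (fun j => g j - f N) =
  upper (f 0%N - g 0%N) (+) upper (f 0%N - g N) (+)
  upper (f N - g 0%N) (+) upper (f N - g N).
Proof.
move=> half N0.
have /addb_grid E : forall i j, (i < N)%N -> (j < N)%N ->
    crossing (f i - g j) (f i.+1 - g j) (+) crossing (f i - g j.+1) (f i.+1 - g j.+1) =
    crossing (f i - g j) (f i - g j.+1) (+) crossing (f i.+1 - g j) (f i.+1 - g j.+1).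
  by move=> i j iN jN; have [k [h1 h2 h3 h4]] := half i j iN jN; apply: (@crossing_square k).
(* A side of the grid borders one column of cells: [i' = 0] for [i = 0] and [i' = N.-1] for
   [i = N]. *)
have side i : (exists i', (i' < N)%N /\ (i = i' \/ i = i'.+1)) ->
    winding N (fun j => f i - g j) (+) winding N (fun j => g j - f i) =
    upper (f i - g 0%N) (+) upper (f i - g N).
  move=> [i' [i'N ii']]; rewrite -(addb_telescope (fun j => upper (f i - g j))) -big_split.
  apply: eq_bigr => j _ /=; have [k [h1 h2 h3 h4]] := half i' j i'N (ltn_ord j).
  by rewrite -[g j - _]opprB -[g j.+1 - _]opprB (@crossingN k) //; case: ii' => ->.
have E0 := side 0%N ltac:(by exists 0%N; split=> //; left).
have EN := side N ltac:(by exists N.-1; rewrite prednK //; split=> //; right).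
rewrite -[RHS]addbA -E0 -EN /winding E.
by rewrite [RHS](AC (2*2) (1*3*2*4)).
Qed.
End Crossing.

(** * Subdividing disjoint arcs *)

Section Arcs.
Variable R : realType.
Implicit Types (g : R -> R * R) (s t : R).

Lemma within_itv_continuous g : {within `[0, 1], continuous g} -> forall s, s \in `[0, 1] -> forall e, 0 < e ->
  \forall t \near s, t \in `[0, 1] -> `|g s - g t| < e.
Proof.
move=> /subspace_continuousP gc s s01 e e0.
have /cvgrPdist_lt /(_ e e0) := gc s s01.
by rewrite near_withinE.
Qed.

Lemma half_nbhs (p : R * R) : p != 0 -> exists2 e, 0 < e & exists i,
  forall q, `|p - q| < e -> in_half i q.
Proof.
case: p => a b; rewrite -[0]/(0, 0) xpair_eqE negb_and => ab0.
have [i ei] : exists i : bool * bool, 0 < (-1) ^+ i.2 * (if i.1 then a else b).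
  case/orP: ab0; rewrite neq_lt => /orP[] h.
  - by exists (true, true); rewrite /= expr1 mulN1r oppr_gt0.
  - by exists (true, false); rewrite /= expr0 mul1r.
  - by exists (false, true); rewrite /= expr1 mulN1r oppr_gt0.
  - by exists (false, false); rewrite /= expr0 mul1r.
exists ((-1) ^+ i.2 * (if i.1 then a else b)) => //; exists i => -[c d].
rewrite prod_normE /= gt_max => /andP[]; rewrite /in_half.
case: i {ei} => [[] []] /=; rewrite ?expr1 ?expr0 ?mulN1r ?mul1r => h1 h2;
by move: h1 h2; rewrite !ltr_norml => /andP[h1 h2] /andP[h3 h4]; lra.
Qed.

(** Locally the nonzero difference stays in one half plane; compactness of the square gives a
    uniform mesh, as for a Lebesgue number. *)
Lemma disjoint_arcs_grid g g' : {within `[0, 1], continuous g} -> {within `[0, 1], continuous g'} ->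
  (forall s t, s \in `[0, 1] -> t \in `[0, 1] -> g s != g' t) ->
  \forall N \near \oo, forall s0 t0, s0 \in `[0, 1] -> t0 \in `[0, 1] -> exists i, forall s t,
     s \in `[0, 1] -> t \in `[0, 1] -> `|s0 - s| <= N.+1%:R^-1 -> `|t0 - t| <= N.+1%:R^-1 ->
     in_half i (g s - g' t).
Proof.
move=> gc g'c dis.
have /compact_near_coveringP cov : compact (`[0, 1] `*` `[0, 1] : set (R * R)).
  by apply: compact_setX; apply: segment_compact.
pose P (N : nat) (x : R * R) := exists i, forall s t,
     s \in `[0, 1] -> t \in `[0, 1] -> `|x.1 - s| <= N.+1%:R^-1 -> `|x.2 - t| <= N.+1%:R^-1 ->
     in_half i (g s - g' t).
suff near_P : \forall N \near \oo, `[0, 1] `*` `[0, 1] `<=` P N.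
  by apply: filterS near_P => N PN s0 t0 s01 t01; apply: (PN (s0, t0)).
apply: cov => -[s1 t1] [/= s1I t1I].
have [e e0 [i ei]] : exists2 e : R, 0 < e & exists i, forall q, `|(g s1 - g' t1) - q| < e -> in_half i q.
  by apply: half_nbhs; rewrite subr_eq0; apply: dis.
have e20 : 0 < e / 2 by rewrite divr_gt0.
have [d /= d0 hd] := within_itv_continuous gc s1I e20.
have [d' /= d'0 hd'] := within_itv_continuous g'c t1I e20.
(* Half of the radius is for the distance to the centre [(s1, t1)], half for the mesh. *)
pose m := Num.min d d' / 2.
have m0 : 0 < m by rewrite divr_gt0 // lt_min d0.
have near_m : \forall x \near (s1, t1), `|(s1, t1) - x| < m.
  have /cvgrPdist_lt /(_ m m0) : id @ (s1, t1) --> (s1, t1) by exact: cvg_id.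
  by [].
near=> x N => /=; exists i => s t sI tI xs xt.
have : `|(s1, t1) - x| < m by near: x.
have : N.+1%:R^-1 < m by near: N; apply: near_infty_natSinv_lt (PosNum m0).
rewrite prod_normE /= gt_max => Nm /andP[sx tx].
have close (a b c k : R) : `|a - b| < m -> `|b - c| <= N.+1%:R^-1 -> m + m <= k -> `|a - c| < k.
  move=> ab bc; apply: lt_le_trans; apply: le_lt_trans (ler_distD b _ _) _.
  by rewrite ltrD // (le_lt_trans bc).
have mm : m + m = Num.min d d' by rewrite /m -splitr.
have gs : `|g s1 - g s| < e / 2.
  by apply: hd sI; apply: close sx xs _; rewrite mm ge_min lexx.
have gt : `|g' t1 - g' t| < e / 2.
  by apply: hd' tI; apply: close tx xt _; rewrite mm ge_min lexx orbT.
apply: ei; rewrite opprB [g' t - _]addrC addrACA [- g' t1 + _]addrC.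
rewrite [e]splitr (le_lt_trans (ler_normD _ _)) // ltrD // distrC //.
Unshelve. all: by end_near.
Qed.
End Arcs.

Theorem planar_mod2_planar (R : realType) (G : sgraph) : planar R G -> mod2_planar (@adj G).
Proof.
move=> [pos [curve [pos_inj arc vert edge]]].
split; [exact: adj_sym|exact: adj_irr|].
pose traces (e : G * G) (g : R -> R * R) := adj e.1 e.2 ->
    [/\ {within `[0, 1], continuous g}, g 0 = pos e.1, g 1 = pos e.2 &
        forall s, s \in `[0, 1] -> curve [set e.1; e.2]%SET (g s)].
have [g gP] : {g & forall e, traces e (g e)}.
  apply: choice => -[x y].
  have [xy|nxy] := boolP (adj x y); last by exists (fun=> 0); rewrite /traces /= (negPf nxy).
  have [g [gc _ g0 g1 gE]] := arc x y xy; exists g => _; split=> // s s01 /=.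
  by rewrite gE; exists s => //; rewrite -in_setE.
pose indep (q : G * G * (G * G)) := [&& adj q.1.1 q.1.2, adj q.2.1 q.2.2 &
   uniq [:: q.1.1; q.1.2; q.2.1; q.2.2]].
pose fine (q : G * G * (G * G)) (N : nat) := forall s0 t0, s0 \in `[0, 1] -> t0 \in `[0, 1] ->
   exists i, forall s t, s \in `[0, 1] -> t \in `[0, 1] ->
     `|s0 - s| <= N.+1%:R^-1 -> `|t0 - t| <= N.+1%:R^-1 ->
     in_half i (g q.1 s - g q.2 t).
have [N0 N0P] : {N0 : _ -> nat & forall q, indep q -> forall N, (N0 q <= N)%N -> fine q N}.
  apply: (@choice _ _ (fun q (n : nat) => indep q -> forall N, (n <= N)%N -> fine q N)) => q.
  have [/and3P[e1 e2 U]|nq] := boolP (indep q); last by exists 0%N.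
  have [c1 _ _ m1] := gP _ e1; have [c2 _ _ m2] := gP _ e2.
  (* A common point of the two arcs would be a vertex, hence an end of both edges. *)
  have dis s t : s \in `[0, 1] -> t \in `[0, 1] -> g q.1 s != g q.2 t.
    move=> s01 t01; apply: contraTneq U => st; have p1 := m1 s s01; have p2 := m2 t t01.
    apply/negP; rewrite /= !inE !negb_or -!andbA => /and5P[_ n1 n2 n3 /andP[n4 _]].
    have [z _ zE] : range pos (g q.1 s).
      apply: (edge _ _ _ _ e1 e2) => [E|]; last by rewrite st in p1 *.
      have := set21 q.1.1 q.1.2; rewrite E !inE (negPf n1) (negPf n2).
      by [].
    rewrite -st -zE in p2; rewrite -zE in p1.
    have [z1|z1] := vert _ _ _ e1 p1; have [z2|z2] := vert _ _ _ e2 p2;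
    by move: n1 n2 n3 n4; rewrite -z1 -z2 eqxx.
  have [N _ NP] := disjoint_arcs_grid c1 c2 dis.
  by exists N => _ M NM; apply: NP.
(* One mesh serves all pairs of disjoint edges, so that [w x y v] depends on no second edge. *)
pose N := (\max_q N0 q)%N.
pose w (x y v : G) := winding N.+1 (fun k => g (x, y) (k%:R / N.+1%:R) - pos v).
exists (fun x y => upper (pos x - pos y)), w; split=> [x y xy|a b c d ab cd U].
  rewrite -[pos y - _]opprB upperN ?negbK // subr_eq0.
  by apply: contraNneq xy => /pos_inj ->.
have fineN : fine ((a, b), (c, d)) N.
  by apply: N0P; [apply/and3P | apply: leq_bigmax].
have [_ g0 g1 _] := gP (a, b) ab; have [_ h0 h1 _] := gP (c, d) cd.
pose f1 k := g (a, b) (k%:R / N.+1%:R); pose f2 k := g (c, d) (k%:R / N.+1%:R).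
have f10 : f1 0%N = pos a by rewrite /f1 mul0r.
have f1N : f1 N.+1 = pos b by rewrite /f1 divff ?pnatr_eq0.
have f20 : f2 0%N = pos c by rewrite /f2 mul0r.
have f2N : f2 N.+1 = pos d by rewrite /f2 divff ?pnatr_eq0.
rewrite /w -f10 -f1N -f20 -f2N; apply: winding_grid => // i j iN jN.
have mem k : (k <= N.+1)%N -> k%:R / N.+1%:R \in `[0 : R, 1].
  by move=> kN; rewrite in_itv /= divr_ge0 //= ler_pdivrMr ?ltr0n // mul1r ler_nat.
have [k kP] := fineN _ _ (mem i (ltnW iN)) (mem j (ltnW jN)).
have step m : `|m%:R / N.+1%:R - m.+1%:R / N.+1%:R| <= N.+1%:R^-1 :> R.
  by rewrite -mulrBl -natr1 opprD addNKr normrM normrN1 mul1r ger0_norm // invr_ge0.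
have still m : `|m%:R / N.+1%:R - m%:R / N.+1%:R| <= N.+1%:R^-1 :> R.
  by rewrite subrr normr0 invr_ge0.
by exists k; split; apply: kP; rewrite ?step ?still // mem // ltnW.
Qed.

(** * The spectral radius *)

Section Perron.
Variables (R : realType) (n : nat) (A : 'M[R]_n.+1).
Implicit Types x y : 'rV[R]_n.+1.

Definition dot x y : R := \sum_i x 0 i * y 0 i.
Definition quad x : R := dot (x *m A) x.

Lemma dotDl x y z : dot (x + y) z = dot x z + dot y z.
Proof. by rewrite -big_split; apply: eq_bigr => i _; rewrite mxE mulrDl. Qed.

Lemma dotC x y : dot x y = dot y x.
Proof. by apply: eq_bigr => i _; rewrite mulrC. Qed.

Lemma dotZl a x y : dot (a *: x) y = a * dot x y.
Proof. by rewrite mulr_sumr; apply: eq_bigr => i _; rewrite mxE mulrA. Qed.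

Lemma dotDr x y z : dot z (x + y) = dot z x + dot z y.
Proof. by rewrite dotC dotDl ![dot _ z]dotC. Qed.

Lemma dotZr a x y : dot x (a *: y) = a * dot x y.
Proof. by rewrite dotC dotZl dotC. Qed.

Lemma quadZ a x : quad (a *: x) = a ^+ 2 * quad x.
Proof. by rewrite /quad -scalemxAl dotZl dotZr mulrA. Qed.

Lemma dot_ge0 x : 0 <= dot x x.
Proof. by apply: sumr_ge0 => i _; rewrite -expr2 sqr_ge0. Qed.

Lemma dot_eq0 x : (dot x x == 0) = (x == 0).
Proof.
apply/idP/eqP => [|->]; last by rewrite /dot big1 // => i _; rewrite mxE mul0r.
rewrite psumr_eq0 => [/allP z|i _]; last by rewrite -expr2 sqr_ge0.
apply/rowP => i; rewrite mxE; apply/eqP.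
by have := z i; rewrite mem_index_enum /= mulf_eq0 orbb => ->.
Qed.

Lemma dot_continuous (f g : 'rV[R]_n.+1 -> 'rV[R]_n.+1) :
  (forall i, continuous (fun x => f x 0 i)) -> (forall i, continuous (fun x => g x 0 i)) ->
  continuous (fun x => dot (f x) (g x)).
Proof.
move=> cf cg; rewrite /dot; apply: (@continuous_big _ _ _ _ xpredT) => [|i _]; first exact: add_continuous.
by move=> x; exact: (cvgM (cf i x) (cg i x)).
Qed.

(** The quadratic form attains its maximum on the unit sphere, a closed subset of a compact box;
    scaling extends the bound to all [y]. *)
Lemma quad_max : exists2 x, dot x x = 1 & forall y, quad y <= quad x * dot y y.
Proof.
pose S := [set x | dot x x = 1] : set 'rV[R]_n.+1.
have cdot : continuous (fun x => dot x x) by apply: dot_continuous; apply: coord_continuous.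
have cquad : continuous quad.
  apply: dot_continuous => i; last exact: coord_continuous.
  under eq_fun do rewrite mxE.
  apply: (@continuous_big _ _ _ _ xpredT) => [|j _]; first exact: add_continuous.
  by move=> x; exact: (cvgM (@coord_continuous _ _ _ 0 j x) (cvg_cst _)).
have S0 : S !=set0.
  exists (delta_mx 0 0); rewrite /S /= /dot (bigD1 0) //= big1 ?mxE ?eqxx ?mulr1 ?addr0 // => i i0.
  by rewrite mxE (negPf i0) andbF mul0r.
have Sc : compact S.
  have box : compact [set v : 'rV[R]_n.+1 | forall i, `[(- 1)%R, 1%R]%classic (v ord0 i)].
    by apply: (@rV_compact R _ (fun=> `[(- 1)%R, 1%R]%classic)) => _; apply: segment_compact.
  apply: subclosed_compact box _.
    apply: (@preimage_closed _ _ (fun x => dot x x) [set 1]); last exact: closed_eq.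
    by move=> z _; exact: cdot.
  move=> v /= v1 i; rewrite in_itv /= -ler_norml -(@expr_le1 _ 2) //.
    rewrite real_normK ?num_real // -[leRHS]v1 /dot (bigD1 i) //= -expr2 lerDl.
    by apply: sumr_ge0 => j _; rewrite -expr2 sqr_ge0.
have [x xS xmax] := EVT_max_rV S0 Sc (continuous_subspaceT cquad).
move: xS; rewrite inE => x1; exists x => // y.
have [->|y0] := eqVneq y 0; first by rewrite -(scale0r (0 : 'rV[R]_n.+1)) quadZ expr0n dotZl !mul0r mulr0.
have yy : 0 < dot y y by rewrite lt_neqAle eq_sym dot_eq0 y0 dot_ge0.
pose c := Num.sqrt (dot y y); have c2 : c ^+ 2 = dot y y by rewrite sqr_sqrtr ?ltW.
have c0 : 0 < c by rewrite sqrtr_gt0.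
have : quad (c^-1 *: y) <= quad x.
  apply: xmax; rewrite inE /S /= dotZl dotC dotZl -c2 mulrA -expr2 -exprMn mulVf ?expr1n //.
  exact: lt0r_neq0.
by rewrite quadZ exprVn c2 mulrC ler_pdivrMr.
Qed.

Hypotheses (A_sym : A^T = A) (A_ge0 : forall i j, 0 <= A i j).

Lemma dot_mulmxC x y : dot (x *m A) y = dot x (y *m A).
Proof.
rewrite /dot; under eq_bigr do rewrite mxE mulr_suml.
rewrite exchange_big; apply: eq_bigr => i _; rewrite mxE mulr_sumr.
by apply: eq_bigr => j _; rewrite -[in RHS]A_sym mxE mulrA mulrAC.
Qed.

(* First variation of the Rayleigh quotient at a maximiser. *)
Lemma quad_max_eigen x l : dot x x = 1 -> quad x = l ->
  (forall y, quad y <= l * dot y y) -> x *m A = l *: x.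
Proof.
move=> x1 xl xmax; have [z zE] : exists z, z = x *m A - l *: x by eexists.
suff: dot z z == 0 by rewrite dot_eq0 zE subr_eq0 => /eqP.
have xz : dot z z = dot (x *m A) z - l * dot x z.
  by rewrite {1}zE dotDl -scaleNr dotZl mulNr.
have key t : 2 * t * dot z z <= t ^+ 2 * (l * dot z z - quad z).
  have := xmax (x + t *: z); have -> : dot (x + t *: z) (x + t *: z) = 1 + 2 * t * dot x z + t ^+ 2 * dot z z.
    by rewrite !(dotDl, dotDr, dotZl, dotZr) x1 [dot z x]dotC; ring.
  have -> : quad (x + t *: z) = l + 2 * t * dot (x *m A) z + t ^+ 2 * quad z.
    rewrite -xl /quad mulmxDl -scalemxAl !(dotDl, dotDr, dotZl, dotZr).
    by rewrite [dot (z *m A) x]dotC -[dot x (z *m A)]dot_mulmxC; ring.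
  by move=> H; rewrite [X in 2 * t * X]xz; lra.
have := dot_ge0 z; rewrite le_eqVlt => /predU1P[<-//|z0].
pose c := l * dot z z - quad z.
have c0 : 0 <= c by rewrite subr_ge0.
have c1 : 0 < c + 1 by rewrite ltr_wpDl.
(* This [t] gives [t * c = dot z z - t], so [key] would yield [t * (dot z z + t) <= 0]. *)
have [t tE] : exists t, t = dot z z / (c + 1) by eexists.
have t0 : 0 < t by rewrite tE divr_gt0.
have tc : t * c = dot z z - t.
  by apply/eqP; rewrite eq_sym subr_eq -[X in _ + X]mulr1 -mulrDr tE divfK ?lt0r_neq0.
have tc2 : t ^+ 2 * c = t * (dot z z - t) by rewrite expr2 -mulrA tc.
have := key t; rewrite -/c tc2 => H.
have : 0 < t * (dot z z + t) by rewrite mulr_gt0 // addr_gt0.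
lra.
Qed.

(** As [A] is nonnegative, taking absolute values of the entries of a maximiser does not lower the
    quadratic form; the result is again a maximiser, hence an eigenvector. *)
Lemma perron_vector : exists (l : R) x,
  [/\ x != 0, forall i, 0 <= x 0 i, x *m A = l *: x &
      forall a, eigenvalue A a -> a <= l].
Proof.
have [x x1 xmax] := quad_max; pose z := \row_i `|x 0 i|.
have z1 : dot z z = 1.
  by rewrite -x1; apply: eq_bigr => i _; rewrite mxE -normrM ger0_norm // -expr2 sqr_ge0.
have zx : quad z = quad x.
  apply: le_anti; have := xmax z; rewrite z1 mulr1 => -> /=.
  apply: ler_sum => i _; rewrite !mxE !mulr_suml; apply: ler_sum => j _; rewrite !mxE.
  by apply: le_trans (ler_norm _) _; rewrite !normrM [`|A j i|]ger0_norm.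
exists (quad x), z; split.
- by rewrite -dot_eq0 z1 oner_eq0.
- by move=> i; rewrite mxE.
- exact: quad_max_eigen.
move=> a /eigenvalueP[y ya y0]; have := xmax y.
by rewrite /quad ya dotZl ler_pM2r // lt_neqAle eq_sym dot_eq0 y0 dot_ge0.
Qed.
End Perron.

Section SpectralRadius.
Variables (R : realType) (G : sgraph).

Definition eigenfun (a : R) (x : G -> R) := forall v, a * x v = \sum_u (adj v u)%:R * x u.

Lemma eigenfunP a (y : 'rV[R]_#|G|) :
  eigenfun a (fun v => y 0 (enum_rank v)) <-> y *m adjmx R G = a *: y.
Proof.
have yA v : (y *m adjmx R G) 0 (enum_rank v) = \sum_u (adj v u)%:R * y 0 (enum_rank u).
  rewrite mxE (reindex (@enum_rank G)) /=; last first.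
    by exists enum_val => ? _; rewrite ?enum_rankK ?enum_valK.
  by apply: eq_bigr => u _; rewrite mxE !enum_rankK mulrC adj_sym.
split=> [ya | ya v]; last by rewrite -yA ya mxE.
by apply/rowP => j; rewrite -[j]enum_valK yA -ya mxE.
Qed.

Lemma eigenfun_eigenvalue a x : eigenfun a x -> (exists v, x v != 0) -> eigenvalue (adjmx R G) a.
Proof.
move=> xa [v xv]; apply/eigenvalueP; exists (\row_j x (enum_val j)).
  apply/eigenfunP => w; rewrite mxE enum_rankK xa.
  by apply: eq_bigr => u _; rewrite mxE enum_rankK.
by apply: contraNneq xv => /rowP/(_ (enum_rank v)); rewrite !mxE enum_rankK => ->.
Qed.

Hypothesis G_gt0 : (0 < #|G|)%N.

Lemma spectral_radiusP :
  (exists x : G -> R, [/\ eigenfun (spectral_radius R G) x, forall v, 0 <= x v & exists v, x v != 0]) /\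
  forall a, eigenvalue (adjmx R G) a -> a <= spectral_radius R G.
Proof.
have A_sym : (adjmx R G)^T = adjmx R G by apply/matrixP => i j; rewrite !mxE adj_sym.
have A_ge0 i j : 0 <= adjmx R G i j by rewrite mxE ler0n.
have [l [x [x0 xpos xl lmax]]] : exists (l : R) (x : 'rV_#|G|),
    [/\ x != 0, forall i, 0 <= x 0 i, x *m adjmx R G = l *: x &
        forall a, eigenvalue (adjmx R G) a -> a <= l].
  move: (adjmx R G) A_sym A_ge0; case: #|G| G_gt0 => // n _ A; exact: perron_vector.
have leig : eigenvalue (adjmx R G) l by apply/eigenvalueP; exists x.
have -> : spectral_radius R G = l.
  apply/le_anti/andP; split.
    by apply: sup_le_ub => [|a /lmax //]; exists l.
  by apply: ub_le_sup => //; exists l => a /lmax.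
split=> //; exists (fun v => x 0 (enum_rank v)); split=> //; first exact/eigenfunP.
have [j xj] : exists j, x 0 j != 0.
  apply/existsP; apply: contraR x0; rewrite negb_exists => /forallP x0.
  by apply/eqP/rowP => j; rewrite mxE; apply/eqP; rewrite -[_ == _]negbK x0.
by exists (enum_val j); rewrite enum_valK.
Qed.

Lemma spectral_radius_ge a x : eigenfun a x -> (exists v, x v != 0) -> a <= spectral_radius R G.
Proof. by move=> xa x0; apply: spectral_radiusP.2; apply: eigenfun_eigenvalue x0. Qed.

Lemma perron_max1 : exists (x : G -> R) u,
  [/\ eigenfun (spectral_radius R G) x, forall v, 0 <= x v <= 1 & x u = 1].
Proof.
have [[x [xr xpos [v0 xv0]]] _] := spectral_radiusP.
pose u := [arg max_(v > v0) x v]%O.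
have umax v : x v <= x u by rewrite /u; case: arg_maxP => // i _; apply.
have xu : 0 < x u by apply: lt_le_trans (umax v0); rewrite lt_neqAle eq_sym xv0 xpos.
exists (fun v => x v / x u), u; split=> [v|v|].
- by rewrite mulrA xr mulr_suml; apply: eq_bigr => w _; rewrite mulrA.
- by rewrite divr_ge0 ?xpos //= ler_pdivrMr // mul1r umax.
- by rewrite divff // gt_eqF.
Qed.

End SpectralRadius.

(** * The double wheel *)

Definition double_wheel (m : nat) : sgraph := join (copies 2 (complete 1)) (cycle_graph m).

(** * A plane drawing of the double wheel *)

Section Drawing.
Variables (R : realType) (M : nat).
Hypothesis M_ge2 : (2 <= M)%N.
Local Notation W := (double_wheel M.+1).

(** Both orientations are given because a drawing needs the same curve as an arc from [x] to [y] and
    from [y] to [x]. *)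
Lemma is_arc_of_continuous (f1 f2 : R -> R) : continuous f1 -> continuous f2 ->
  (forall s t : R, 0 <= s <= 1 -> 0 <= t <= 1 -> f1 s = f1 t -> f2 s = f2 t -> s = t) ->
  let A := [set p | exists2 t, 0 <= t <= 1 & p = (f1 t, f2 t)] in
  is_arc A (f1 0, f2 0) (f1 1, f2 1) /\ is_arc A (f1 1, f2 1) (f1 0, f2 0).
Proof.
move=> c1 c2 inj A; pose g t := (f1 t, f2 t).
have cg : continuous g by move=> t; exact: (cvg_pair (c1 t) (c2 t)).
have crev : continuous (fun t : R => 1 - t) by move=> t; apply: cvgB; [apply: cvg_cst|apply: cvg_id].
have rev01 (t : R) : 0 <= t <= 1 -> 0 <= 1 - t <= 1 by move=> ?; lra.
split.
  exists g; split=> //.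
  - exact: continuous_subspaceT.
  - move=> s t; rewrite !inE /= !in_itv /= => s01 t01 [e1 e2]; exact: inj.
  - rewrite predeqE => p; split=> [[t t01 ->]|[t t01 <-]]; exists t => //; rewrite /= ?in_itv //.
exists (fun t => g (1 - t)); split=> //.
- by apply: continuous_subspaceT => t; apply: (continuous_comp (crev t) (cg _)).
- move=> s t; rewrite !inE /= !in_itv /= => /rev01 s01 /rev01 t01 [e1 e2].
  by have := inj _ _ s01 t01 e1 e2; lra.
- by rewrite /g subr0.
- by rewrite /g subrr.
- rewrite predeqE => p; split=> [[t /rev01 t01 ->]|[t + <-]].
    by exists (1 - t); rewrite /= ?in_itv //= /g opprB addrC subrK.
  by rewrite /= in_itv /= => /rev01 t01; exists (1 - t).
Qed.

Definition height (a : 'I_2) : R := (-1) ^+ a.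

Definition wheel_pos (z : W) : R * R :=
  match z with inl a => (1, height a.1) | inr i => (i%:R, 0) end.

(* [inl (a, i)] is the spoke from the apex [a] to the rim vertex [i], and [inr i]
   the rim edge from [i] to its successor. *)
Local Notation wedge := (('I_2 * 'I_M.+1) + 'I_M.+1)%type.

Definition src (e : wedge) : W := match e with inl (_, i) => inr i | inr i => inr i end.
Definition tgt (e : wedge) : W :=
  match e with inl (a, _) => inl (a, ord0) | inr i => inr (ordS i) end.

(* The rim lies on the x-axis, except for the edge from [M] to [0], which is drawn
   as a parabola above the upper apex. *)
Definition wheel_path (e : wedge) : (R -> R) * (R -> R) :=
  match e with
  | inl (a, i) => ((fun t => 1 + (1 - t) * (i%:R - 1)), (fun t => height a * t))
  | inr i => if i == M :> nat
             then ((fun t => M%:R * (1 - t)), (fun t => 2 * (M%:R * (1 - t)) * (M%:R * t)))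
             else ((fun t => i%:R + t), (fun=> 0))
  end.

Definition wheel_points (e : wedge) : set (R * R) :=
  [set p | exists2 t, 0 <= t <= 1 & p = ((wheel_path e).1 t, (wheel_path e).2 t)].

Definition wheel_curve (S : {set W}) : set (R * R) :=
  if [pick e | [set src e; tgt e]%SET == S] is Some e then wheel_points e else set0.

Lemma height_neq0 a : height a != 0. Proof. by rewrite signr_eq0. Qed.

Lemma height_norm a : `|height a| = 1. Proof. by rewrite normr_sign. Qed.

Lemma height_inj : injective height.
Proof.
move=> [[|[|//]] i] [[|[|//]] j]; rewrite /height /= ?expr0 ?expr1 => E; apply: val_inj => //=;
by exfalso; lra.
Qed.

Lemma wheel_path_src e : ((wheel_path e).1 0, (wheel_path e).2 0) = wheel_pos (src e).
Proof.
case: e => [[a i]|i] /=; first by rewrite subr0 mul1r addrC subrK mulr0.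
by case: eqP => [->|_] /=; rewrite ?subr0 ?mulr1 ?mulr0 ?addr0.
Qed.

Lemma wheel_path_tgt e : ((wheel_path e).1 1, (wheel_path e).2 1) = wheel_pos (tgt e).
Proof.
case: e => [[a i]|i] /=; first by rewrite subrr mul0r addr0 mulr1.
case: eqP => [->|iM] /=; first by rewrite subrr mulr0 modnn !mulr0 mul0r.
by rewrite modn_small ?natr1 //; have := ltn_ord i; lia.
Qed.

Lemma wheel_path_arc e : is_arc (wheel_points e) (wheel_pos (src e)) (wheel_pos (tgt e)) /\
  is_arc (wheel_points e) (wheel_pos (tgt e)) (wheel_pos (src e)).
Proof.
rewrite -wheel_path_src -wheel_path_tgt.
have cid : continuous (fun t : R => t) by move=> t; apply: cvg_id.
have ccst (c : R) : continuous (fun _ : R => c) by move=> t; apply: cvg_cst.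
have crev : continuous (fun t : R => 1 - t) by move=> t; apply: cvgB; [apply: cvg_cst|apply: cvg_id].
have cmul (f g : R -> R) : continuous f -> continuous g -> continuous (fun t => f t * g t).
  by move=> cf cg t; apply: cvgM; [apply: cf|apply: cg].
have cadd (f g : R -> R) : continuous f -> continuous g -> continuous (fun t => f t + g t).
  by move=> cf cg t; apply: cvgD; [apply: cf|apply: cg].
have M0 : M%:R != 0 :> R by rewrite pnatr_eq0; lia.
apply: is_arc_of_continuous; case: e => [[a i]|i] /=; try case: ifP => _ /=.
- by apply: (cadd _ _ (ccst _)); apply/cmul.
- exact: cmul.
- by apply: (cadd _ _ (ccst _)).
- by apply/cmul.
- by apply/cmul; apply/cmul => //; apply/cmul.
- exact: ccst.
- by move=> s t _ _ _ /(mulfI (height_neq0 a)).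
- by move=> s t _ _ /(mulfI M0) E _; lra.
- by move=> s t _ _ /addrI.
Qed.

(** Links are the edges lying on the x-axis; by [off_axis] all others meet that axis only in their
    ends. *)
Definition is_link (e : wedge) := if e is inr i then i != M :> nat else false.

Lemma link_points (i : 'I_M.+1) p : i != M :> nat -> wheel_points (inr i) p ->
  exists2 t, 0 <= t <= 1 & p = (i%:R + t, 0).
Proof. by move=> iM [t t01 ->]; exists t; rewrite //= (negPf iM). Qed.

Lemma off_axis e p : ~~ is_link e -> wheel_points e p -> p.2 = 0 -> 
  p = wheel_pos (src e) \/ p = wheel_pos (tgt e).
Proof.
rewrite -wheel_path_src -wheel_path_tgt; case: e => [[a i]|i] /= + [t t01 ->] /=.
  by move=> _ /eqP; rewrite mulf_eq0 (negPf (height_neq0 a)) /= => /eqP ->; left.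
rewrite negbK => iM; rewrite iM /= => /eqP.
have M0 : M%:R == 0 :> R = false by rewrite pnatr_eq0; lia.
rewrite !mulf_eq0 pnatr_eq0 M0 /= subr_eq0 => /orP[]/eqP; last by move=> ->; left.
by move=> <-; right.
Qed.

Lemma range_src e : range wheel_pos (wheel_pos (src e)).
Proof. by exists (src e). Qed.

Lemma range_tgt e : range wheel_pos (wheel_pos (tgt e)).
Proof. by exists (tgt e). Qed.

(* Concavity of the parabola keeps the spokes strictly below it. *)
Lemma spoke_parabola (i : 'I_M.+1) (h x y : R) : 0 <= h <= 1 -> 0 <= x * (M%:R - x) ->
  x = 1 + (1 - h) * (i%:R - 1) -> `|y| = h -> y = 2 * (x * (M%:R - x)) -> h = 0.
Proof.
move=> h01 x0 xE yh yE.
have M2 : 2 <= M%:R :> R by rewrite (ler_nat _ 2).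
have i0 : 0 <= i%:R :> R by rewrite ler0n.
have iM : i%:R <= M%:R :> R by rewrite ler_nat -ltnS.
have hE : h = 2 * (x * (M%:R - x)) by rewrite -yh yE ger0_norm // mulr_ge0.
(* Linear interpolation between the ends of the spoke plus a concavity term; all summands are
   nonnegative and [M >= 2], so [x * (M - x) >= h], whence [h >= 2 * h]. *)
have cc : x * (M%:R - x) = (1 - h) * (i%:R * (M%:R - i%:R)) + h * (M%:R - 1) + h * (1 - h) * (i%:R - 1) ^+ 2.
  by rewrite xE; ring.
have [h0 h1] := andP h01.
have p1 : 0 <= (1 - h) * (i%:R * (M%:R - i%:R)) by rewrite !mulr_ge0 // subr_ge0.
have p2 : 0 <= h * (1 - h) * (i%:R - 1) ^+ 2 by rewrite mulr_ge0 ?sqr_ge0 // mulr_ge0 // subr_ge0.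
have p3 : h <= h * (M%:R - 1) by rewrite ler_peMr //; lra.
lra.
Qed.

(** Any meeting that involves a link lies on the axis. Two spokes meet at equal height, so at an
    apex or on the axis; [spoke_parabola] settles a spoke and the parabola. *)
Lemma wheel_points_meet e e' p : e != e' -> wheel_points e p -> wheel_points e' p ->
  range wheel_pos p.
Proof.
have axis f : ~~ is_link f -> wheel_points f p -> p.2 = 0 -> range wheel_pos p.
  by move=> lf fp p0; have [->|->] := off_axis lf fp p0; [apply: range_src|apply: range_tgt].
have links (i j : 'I_M.+1) : i != M :> nat -> j != M :> nat -> (i < j)%N ->
    wheel_points (inr i) p -> wheel_points (inr j) p -> range wheel_pos p.
  move=> iM jM ij /(link_points iM)[t t01 ->] /(link_points jM)[t' t'01 []] E.
  have ij1 : i%:R + 1 <= j%:R :> R by rewrite natr1 ler_nat.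
  by exists (inr j) => //=; congr (_, _); lra.
have spoke (a : 'I_2) (i : 'I_M.+1) f : inl (a, i) != f -> ~~ is_link f ->
    wheel_points (inl (a, i)) p -> wheel_points f p -> range wheel_pos p.
  move=> ef lf ep fp; case: (ep) => h h01 pE; case: f => [[b j]|j] in ef lf fp *.
    case: (fp) => h' h'01; rewrite pE /= => -[E1 E2].
    have hh : h = h'.
      have := congr1 Num.norm E2; rewrite !normrM !height_norm !mul1r !ger0_norm //; lra.
    subst h'.
    have [h0|h0] := eqVneq h 0; first by rewrite -pE; apply: axis ep _; rewrite ?pE //= h0 mulr0.
    have ab : a = b by apply: height_inj; apply: mulIf E2.
    have [h1|h1] := eqVneq h 1.
      exists (inl (a, ord0)) => //=; rewrite h1; congr (_, _); lra.
    have : (1 - h) * (i%:R - 1) = (1 - h) * (j%:R - 1) by lra.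
    have h1' : 1 - h != 0 by rewrite subr_eq0 eq_sym.
    move=> /(mulfI h1')/addIr/eqP; rewrite eqr_nat => /eqP/val_inj ij.
    by rewrite ab ij eqxx in ef.
  move: lf fp; rewrite /= negbK => jM; case=> t t01; rewrite pE /= jM => -[E1 E2].
  rewrite -pE; apply: (axis _ _ ep) => //; rewrite pE /=.
  have M0 : 0 <= M%:R :> R by rewrite ler0n.
  rewrite (_ : h = 0) ?mulr0 //.
  apply: (@spoke_parabola i h (M%:R * (1 - t)) (height a * h)) => //.
  - by rewrite mulr_ge0 ?mulr_ge0 //; nra.
  - by rewrite normrM height_norm mul1r ger0_norm //; lra.
  - by rewrite E2; ring.
move=> ee' ep e'p; have [le|nle] := boolP (is_link e); have [le'|nle'] := boolP (is_link e').
- case: e e' le le' ee' ep e'p => [//|i] [//|j] /= iM jM ij ep e'p.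
  have [ij'|ij'|ij'] := ltngtP (i : nat) (j : nat); [exact: (links i j)|exact: (links j i)|].
  by move: ij; rewrite (val_inj ij') eqxx.
- by apply: (axis e') => //; case: e le ep {ee'} => [//|i] /= iM /(link_points iM)[t _ ->].
- by apply: (axis e) => //; case: e' le' e'p {ee'} => [//|i] /= iM /(link_points iM)[t _ ->].
case: e ee' nle ep => [[a i]|i] ee' nle ep; first exact: spoke ee' nle' ep e'p.
case: e' ee' nle' e'p => [[b j]|j] ee' nle' e'p; first by rewrite eq_sym in ee'; apply: spoke ee' nle e'p ep.
by move: nle nle' ee'; rewrite /= !negbK => /eqP iM /eqP jM; rewrite (val_inj (etrans iM (esym jM))) eqxx.
Qed.

Lemma wheel_pos_inj : injective wheel_pos.
Proof.
move=> [[a a']|i] [[b b']|j] /= [].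
- by move=> /height_inj ->; rewrite (ord1 a') (ord1 b').
- by move=> _ /eqP; rewrite (negPf (height_neq0 a)).
- by move=> _ /esym/eqP; rewrite (negPf (height_neq0 b)).
- by move=> /eqP; rewrite eqr_nat => /eqP/val_inj ->.
Qed.

Lemma wheel_points_vertex e z : wheel_points e (wheel_pos z) -> z = src e \/ z = tgt e.
Proof.
have M2 : 2 <= M%:R :> R by rewrite (ler_nat _ 2).
move=> ez; have [le|nle] := boolP (is_link e); last first.
  case: z ez => [[b b']|j] ez; last first.
    by have [/wheel_pos_inj|/wheel_pos_inj] := off_axis nle ez erefl; [left|right].
  case: e nle ez => [[a i] _|i] /=.
    case=> t t01 [_ E]; right; rewrite (ord1 b').
    have t1 : t = 1.
      by have := congr1 Num.norm E; rewrite normrM !height_norm mul1r ger0_norm //; lra.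
    by move: E; rewrite t1 mulr1 => /height_inj ->.
  (* At abscissa 1 the parabola has height [2 * (M - 1) >= 2], so it misses the apices. *)
  rewrite negbK => iM; case=> t t01; rewrite /= iM /= => -[E1 E2].
  have := congr1 Num.norm E2; rewrite height_norm -E1 ger0_norm; last by rewrite !mulr_ge0 //; lra.
  by move=> E3; exfalso; lra.
case: e le ez => [//|i] /= iM /(link_points iM)[t t01].
case: z => [[b b'] [_ E2]|j [E1]]; first by have := height_neq0 b; rewrite E2 eqxx.
have ji : (i <= j <= i.+1)%N.
  by apply/andP; split; rewrite -(ler_nat R) E1 -?natr1; lra.
have [->|nij] := eqVneq j i; [by left|right].
congr inr; apply: val_inj => /=; rewrite modn_small; first by move: nij; rewrite -val_eqE /=; lia.
by have := ltn_ord i; lia.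
Qed.

Lemma wheel_edge x y : @adj W x y -> exists e, [set src e; tgt e]%SET = [set x; y]%SET.
Proof.
have spoke a a' i : exists e, [set src e; tgt e]%SET = [set (inl (a, a') : W); inr i]%SET.
  by exists (inl (a, i)); rewrite finset.setUC /= (ord1 a').
have rim (i j : 'I_M.+1) : (i.+1 == j %[mod M.+1])%N ->
    exists e, [set src e; tgt e]%SET = [set (inr i : W); inr j]%SET.
  rewrite [X in _ == X]modn_small // => /eqP ij; exists (inr i); congr (finset.setU _ [set (inr _)])%SET.
  exact: val_inj.
case: x y => [[a a']|i] [[b b']|j] //=.
- by rewrite /copies_adj /= /complete_adj (ord1 a') (ord1 b') eqxx andbF.
- by move=> _; have [e E] := spoke b b' i; exists e; rewrite E finset.setUC.
- by case/andP => _ /orP[/rim //|/rim[e E]]; exists e; rewrite E finset.setUC.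
Qed.

Theorem double_wheel_planar : planar R W.
Proof.
exists wheel_pos, wheel_curve.
have curveE x y : @adj W x y -> exists2 e, [set src e; tgt e]%SET = [set x; y]%SET &
    wheel_curve [set x; y]%SET = wheel_points e.
  rewrite /wheel_curve => /wheel_edge[e0 e0E]; case: pickP => [e /eqP eE|/(_ e0)]; first by exists e.
  by rewrite e0E eqxx.
split.
- exact: wheel_pos_inj.
- move=> x y xy; have [e eE ->] := curveE x y xy.
  have [arc1 arc2] := wheel_path_arc e.
  have xy' : x != y by apply: contraTneq xy => ->; rewrite adj_irr.
  have := set21 (src e) (tgt e); have := set22 (src e) (tgt e); rewrite eE !inE.
  have := set21 x y; have := set22 x y; rewrite -eE !inE.
  by do 4!case/orP=> /eqP ?; subst => //; rewrite ?eqxx in xy'.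
- move=> x y z xy; have [e eE ->] := curveE x y xy => /wheel_points_vertex ez.
  have : z \in [set x; y]%SET by rewrite -eE !inE; case: ez => ->; rewrite eqxx ?orbT.
  by rewrite !inE => /orP[]/eqP; [left|right].
- move=> x y u v xy uv; have [e <- ->] := curveE x y xy; have [f <- ->] := curveE u v uv.
  move=> ef p [ep fp]; apply: wheel_points_meet ep fp.
  by apply: contra_not_neq ef => ->.
Qed.

End Drawing.

(** * Forbidden subgraph and spectral radius of the double wheel *)

Section DoubleWheel.
Variable m : nat.
Hypothesis m_gt3 : (3 < m)%N.

Lemma ordS_val (i j : 'I_m) : j = ordS i -> (j = i.+1 :> nat \/ i.+1 = m /\ j = 0 :> nat)%N.
Proof.
move=> -> /=; have [->|im] := eqVneq i.+1 m; first by rewrite modnn; right.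
by left; rewrite modn_small //; have := ltn_ord i; lia.
Qed.

Lemma cycle_adjE (i j : 'I_m) : cycle_adj i j = (j == ordS i) || (i == ordS j).
Proof.
have small (k : 'I_m) : (k %% m = k)%N by rewrite modn_small.
rewrite /cycle_adj -[j == _]val_eqE -[i == ordS j]val_eqE /= !small ![(_ %% m)%N == _]eq_sym.
case: eqP => //= ij; apply/esym/negP; rewrite ij orbb => /eqP E.
have /ordS_val : j = ordS j by exact: val_inj.
lia.
Qed.

Lemma cycle_adj_val (i j : 'I_m) : cycle_adj i j ->
  [\/ j = i.+1 :> nat, i = j.+1 :> nat, i.+1 = m /\ j = 0 :> nat | j.+1 = m /\ i = 0 :> nat]%N.
Proof.
by rewrite cycle_adjE => /orP[]/eqP/ordS_val[]; [constructor 1|constructor 3|constructor 2|constructor 4].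
Qed.

Lemma cycle_triangle_free (i j k : 'I_m) :
  cycle_adj i j -> cycle_adj j k -> cycle_adj i k -> False.
Proof. by move=> /cycle_adj_val[] ? /cycle_adj_val[] ? /cycle_adj_val[] ?; lia. Qed.

Lemma cycle_degree (i : 'I_m)  : (\sum_j cycle_adj i j = 2)%N.
Proof.
have -> : (\sum_j cycle_adj i j)%N = #|[set ordS i; ord_pred i]%SET|.
  rewrite -sum1_card [RHS]big_mkcond; apply: eq_bigr => j _; rewrite !inE cycle_adjE.
  have -> : (i == ordS j) = (j == ord_pred i).
    by apply/eqP/eqP => ->; rewrite ?ordSK ?ord_predK.
  by case: (_ || _).
rewrite cards2; case: eqP => // E.
have /ordS_val : i = ordS (ordS i) by rewrite E ord_predK.
have /ordS_val : ordS i = ordS i by [].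
lia.
Qed.

(** The apices are nonadjacent, so a K_4 would contain three rim vertices and hence a triangle of
    the cycle. *)
Lemma double_wheel_K4_free (x y z t : double_wheel m) :
  [&& adj x y, adj x z & adj x t] -> [&& adj y z, adj y t & adj z t] -> False.
Proof.
have apex (a b : copies 2 (complete 1)) : adj a b -> False.
  by case: a b => [a a'] [b b']; rewrite /= /copies_adj /= /complete_adj (ord1 a') (ord1 b') eqxx andbF.
case/and3P=> + + + /and3P[].
by case: x y z t => [x|x] [y|y] [z|z] [t|t] /=; move=> xy xz xt yz yt zt;
  first [exact: apex xy|exact: apex xz|exact: apex xt|exact: apex yz|exact: apex yt|exact: apex zt|exact: cycle_triangle_free yz zt yt | exact: cycle_triangle_free xz zt xt
        |exact: cycle_triangle_free xy yt xt | exact: cycle_triangle_free xy yz xz].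
Qed.

(** For positive [p] the forbidden graph contains a K_4. *)
Lemma double_wheel_free p : (0 < p)%N ->
  free (join (complete 2) (copies p (complete 2))) (double_wheel m).
Proof.
case: p => // p _ [f finj fadj].
pose u : join (complete 2) (copies p.+1 (complete 2)) := inl ord0.
pose v : join (complete 2) (copies p.+1 (complete 2)) := inl ord_max.
pose a : join (complete 2) (copies p.+1 (complete 2)) := inr (ord0, ord0).
pose b : join (complete 2) (copies p.+1 (complete 2)) := inr (ord0, ord_max).
by apply: (@double_wheel_K4_free (f u) (f v) (f a) (f b)); apply/and3P; split; apply: fadj.
Qed.

Lemma card_double_wheel : #|double_wheel m| = m.+2.
Proof. by rewrite card_sum card_prod !card_ord muln1. Qed.

(** The function [t] on the apices and 1 on the rim is an eigenfunction. *)
Lemma double_wheel_spectral (R : realType) (t : R) : t * (t * 2 + 2) = m%:R ->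
  t * 2 + 2 <= spectral_radius R (double_wheel m).
Proof.
move=> tE; have t0 : t != 0.
  by apply: contra_eq_neq tE => ->; rewrite mul0r eq_sym pnatr_eq0; lia.
pose x (z : double_wheel m) := if z is inl _ then t else 1.
apply: (@spectral_radius_ge _ _ _ _ x); [by rewrite card_double_wheel| |by exists (inr (Ordinal (ltnW (ltnW (ltnW m_gt3))))); rewrite oner_eq0].
move=> v; rewrite big_sumType /=; case: v => [a|i] /=.
  rewrite big1 => [|u _]; last first.
    by case: a u => [a a'] [b b']; rewrite /= /copies_adj /= /complete_adj (ord1 a') (ord1 b') eqxx andbF mul0r.
  by rewrite add0r sumr_const card_ord mulr1 mulrC tE.
rewrite sumr_const card_prod !card_ord mul1r.
under [X in _ = _ + X]eq_bigr do rewrite mulr1.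
by rewrite -natr_sum cycle_degree mulr1 muln1 mulr_natr.
Qed.
End DoubleWheel.

Local Close Scope classical_set_scope.
Local Close Scope ring_scope.

(** * The rim is a cycle *)

Section Rim.
Variables (V : finType) (r : rel V).
Hypothesis rP : mod2_planar r.

Let rs : symmetric r. Proof. by case: rP. Qed.
Let ri : irreflexive r. Proof. by case: rP. Qed.

(** Extend a path at its head [a] until both neighbours of [a] lie on it; the one that is not the
    second vertex closes a cycle. *)
Lemma ucycle_of_degree2 (A : {set V}) : A != finset.set0 -> {in A, forall x, #|nbrs r A x| = 2} ->
  exists s, [/\ ucycle r s, 2 < size s & {subset s <= A}].
Proof.
move=> A0 A2.
suff grow k a p : #|A| - size (a :: p) < k -> path r a p -> uniq (a :: p) -> {subset a :: p <= A} ->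
    exists s, [/\ ucycle r s, 2 < size s & {subset s <= A}].
  have /set0Pn[a aA] := A0; apply: (grow _ a [::] (ltnSn _)) => // y; rewrite inE => /eqP -> //.
elim: k a p => // k IH a p; rewrite ltnS => pk pth U pA.
have aA : a \in A by rewrite pA ?inE ?eqxx.
have [[b /andP[]]|all_in] := altP (@existsP _ (fun b => (b \in nbrs r A a) && (b \notin a :: p))).
  rewrite inE => /andP[bA ab] bp; have U' : uniq (b :: a :: p) by rewrite cons_uniq bp.
  have pA' : {subset b :: a :: p <= A}.
    by move=> y; rewrite inE => /predU1P[->//|]; apply: pA.
  apply: (IH b (a :: p)) => //; last by rewrite /= rs ab.
  have : size (b :: a :: p) <= #|A|.
    by rewrite cardE; apply: uniq_leq_size => // y yp; rewrite mem_enum pA'.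
  by move: pk; rewrite /=; lia.
have nbr_in b : b \in A -> r a b -> b \in p.
  move=> bA ab; apply: contraNT all_in => bp; apply/existsP; exists b.
  have ba : b != a by apply: contraTneq ab => ->; rewrite ri.
  by rewrite !inE bA ab negb_or ba bp.
case: p pth U pA nbr_in {pk all_in IH} => [|b0 p] /=.
  move=> _ _ _ no; have := A2 a aA; suff -> : nbrs r A a = finset.set0 by rewrite cards0.
  by apply/setP => y; rewrite !inE; apply/negP => /andP[/no yno /yno].
case/andP => ab0 pth /and3P[ab b0p up] pA nbr_in.
have /card_gt1P [c [d [cN dN cd]]] : 1 < #|nbrs r A a| by rewrite A2.
have [e [eA ae eb0]] : exists e, [/\ e \in A, r a e & e != b0].
  have [cb|cb] := eqVneq c b0.
    by exists d; move: dN cd; rewrite inE cb eq_sym => /andP[].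
  by exists c; move: cN; rewrite inE => /andP[].
have := nbr_in e eA ae; rewrite inE (negPf eb0) /= => ep.
case/splitPr: ep pth ab b0p up pA {nbr_in} => p1 p2 pth ab b0p up pA.
exists (a :: b0 :: rcons p1 e); split.
- apply/andP; split.
    rewrite /= rcons_path last_rcons ab0 rs ae andbT /= -cats1.
    by move: pth; rewrite !cat_path /= => /and3P[-> -> _].
  apply: subseq_uniq (_ : uniq (a :: b0 :: p1 ++ e :: p2)); last by rewrite /= ab b0p.
  by rewrite -cat_rcons -!cat_cons prefix_subseq.
- by rewrite /= size_rcons.
- move=> y yp; apply: pA; move: yp; rewrite !inE mem_rcons mem_cat !inE.
  by case/or4P=> [->|->|->|->]; rewrite ?orbT.
Qed.

Lemma next_neq_prev (s : seq V) x : uniq s -> 2 < size s -> x \in s -> next s x != prev s x.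
Proof.
move=> U s2 xs; have [i s' E] := rot_to xs.
rewrite -(next_rot i U) -(prev_rot i U) E.
have {U} U : uniq (x :: s') by rewrite -E rot_uniq.
have {s2} : 2 < size (x :: s') by rewrite -E size_rot.
case: s' U {E} => [|y [|z s']] //= U _.
rewrite !eqxx /=; case/and4P: U; rewrite !inE !negb_or => /and3P[/negPf-> /negPf-> xs'] ys' _ _.
have last_in : prev_at x x z s' \in z :: s'.
  elim: s' z xs' {ys'} => [|t s' IH] z /=; first by rewrite eqxx inE.
  by rewrite inE negb_or => /andP[/negPf-> /(IH t) h]; rewrite inE h orbT.
by apply: contraTneq last_in => <-; rewrite inE negb_or.
Qed.

Lemma nth_next (x0 : V) (s : seq V) i : uniq s -> i < size s ->
  next s (nth x0 s i) = nth x0 s (i.+1 %% size s).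
Proof.
case: s => // y s U iS; rewrite next_nth mem_nth // index_uniq //.
have [ls|ls] := ltnP i (size s); first by rewrite modn_small //= (set_nth_default x0).
have -> : i = size s by apply/eqP; rewrite eqn_leq ls andbT -ltnS.
by rewrite nth_default // modnn.
Qed.

Variables (u w : V).
Hypotheses (wu : w != u) (uw : ~~ r u w).
Local Notation A := [set v | (v != u) && (v != w)]%SET.
Hypotheses (hubs : forall v, v != u -> v != w -> r u v && r w v)
  (rim2 : forall v, v != u -> v != w -> #|nbrs r A v| = 2).

(* If a component [X] of the rim missed the rim vertex [v], contracting [u v] would
   make [u] and [w] adjacent apices over [X], and [X] would have too many edges. *)
Lemma rim_connected (X : {set V}) : X \subset A -> X != finset.set0 ->
  (forall x y, x \in X -> y \in A -> r x y -> y \in X) -> X = A.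
Proof.
move=> XA X0 Xcl; apply/eqP; rewrite finset.eqEsubset XA /=; apply/fintype.subsetP => v vA.
apply: contraT => vX; have /andP[vu vw] : (v != u) && (v != w) by rewrite inE in vA.
have /andP[uv wv] := hubs vu vw.
have XP x : x \in X -> [/\ x != u, x != w & x != v].
  move=> xX; have := fintype.subsetP XA x xX; rewrite inE => /andP[-> ->]; split=> //.
  by apply: contraNneq vX => <-.
have := degsum_two_apices (mod2_planar_contract rP uv) (U := X) (a := u) (b := w) _ _ X0.
rewrite ltnNge => /(_ _ _)/negP H; case: H.
- by rewrite /contract [u == v]eq_sym vu [w == v]eq_sym vw [u == w]eq_sym wu eqxx [r v w]rs wv orbT.
- move=> x /XP[xu xw xv]; have /andP[ux wx] := hubs xu xw.
  by rewrite /contract ux wx xv ![_ == v]eq_sym vu vw ![_ == x]eq_sym xu xw.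
apply: leq_trans (leq_degsum (r := r) _); last first.
  move=> x y /XP[xu xw xv] /XP[yu yw yv] xy; rewrite /contract xv yv xy andbT /=.
  by apply: contraTneq xy => ->; rewrite ri.
rewrite /degsum mulnC -sum_nat_const; apply: leq_sum => x xX; have [xu xw _] := XP x xX.
rewrite -(rim2 xu xw); apply/subset_leq_card/fintype.subsetP => y.
by rewrite [y \in nbrs r A x]inE => /andP[yA xy]; rewrite inE xy (Xcl x).
Qed.

(** A cycle in the 2-regular rim is closed under adjacency, hence is the whole rim by
    [rim_connected]; numbering the rim along it gives the isomorphism. *)
Lemma double_wheel_iso : 5 < #|V| -> exists g : double_wheel (#|V| - 2) -> V,
  bijective g /\ forall x y, r (g x) (g y) = adj x y.
Proof.
move=> V5.
have cardA : #|A| = #|V| - 2.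
  rewrite -(cardsC [set u; w]%SET) cards2 eq_sym wu addKn.
  by apply: eq_card => v; rewrite !inE negb_or.
have A0 : A != finset.set0 by rewrite -card_gt0 cardA subn_gt0 (leq_trans _ V5).
have [|s [/andP[cyc U] s2 sA]] := ucycle_of_degree2 A0.
  by move=> v; rewrite inE => /andP[]; apply: rim2.
have sP x : x \in s -> (x != u) && (x != w) by move/sA; rewrite inE.
have nbrE x y : x \in s -> y \in A -> r x y = (y == next s x) || (y == prev s x).
  move=> xs yA; have /andP[xu xw] := sP x xs.
  have nx : r x (next s x) := next_cycle cyc xs.
  have px : r x (prev s x) by rewrite rs; apply: prev_cycle cyc xs.
  have E : [set next s x; prev s x]%SET = nbrs r A x.
    apply/eqP; rewrite eqEcard rim2 // cards2 next_neq_prev // andbT.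
    by apply/fintype.subsetP => z; rewrite !inE => /orP[]/eqP->; rewrite ?nx ?px sP ?mem_next ?mem_prev.
  by have := congr1 (fun S : {set V} => y \in S) E; rewrite !inE; move: yA; rewrite inE => -> /= <-.
have sE : [set x in s]%SET = A.
  apply: rim_connected => [||x y].
  - by apply/fintype.subsetP => x; rewrite inE; apply: sA.
  - by apply/set0Pn; exists (head u s); rewrite inE; case: (s) s2 => //= a p _; rewrite inE eqxx.
  - by rewrite !inE => xs yA; rewrite nbrE ?inE // => /orP[]/eqP->; rewrite ?mem_next ?mem_prev.
have sizes : size s = #|V| - 2.
  by rewrite -cardA -sE cardsE; apply/esym/card_uniqP.
rewrite -sizes.
pose g (z : double_wheel (size s)) : V :=
  match z with inl a => if a.1 == ord0 then u else w | inr i => nth u s i end.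
have gs (i : 'I_(size s)) : nth u s i \in s by rewrite mem_nth.
have hub_rim (a : 'I_2) (i : 'I_(size s)) : (if a == ord0 then u else w) != nth u s i.
  by have /andP[iu iw] := sP _ (gs i); case: ifP => _; rewrite eq_sym.
exists g; split.
  apply: inj_card_bij; last by rewrite card_double_wheel sizes; lia.
  case=> [[a a']|i] [[b b']|j] /= E.
  - rewrite (ord1 a') (ord1 b'); congr (inl (_, _)); move: E.
    by case: a b => [[|[|//]] ?] [[|[|//]] ?] //= E; apply: val_inj => //=; move: wu; rewrite E eqxx.
  - by have := hub_rim a j; rewrite E eqxx.
  - by have := hub_rim b i; rewrite E eqxx.
  - by congr inr; apply/val_inj/eqP; rewrite -(nth_uniq u (ltn_ord i) (ltn_ord j) U); apply/eqP.
case=> [[a a']|i] [[b b']|j] /=.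
- rewrite /copies_adj /= /complete_adj (ord1 a') (ord1 b') eqxx andbF.
  by case: ifP => _; case: ifP => _; rewrite ?ri ?[r w u]rs; apply: negbTE.
- have /andP[iu iw] := sP _ (gs j); have /andP[uj wj] := hubs iu iw; by case: ifP.
- have /andP[iu iw] := sP _ (gs i); have /andP[uj wj] := hubs iu iw.
  by rewrite rs; case: ifP.
have s3 : 3 < size s by lia.
have jA : nth u s j \in A by apply/sA/gs.
rewrite (nbrE _ _ (gs i) jA) cycle_adjE // -[j == _]val_eqE -[i == _]val_eqE /=.
(* Being the predecessor is restated through [next], which matches [ordS] on indices. *)
rewrite -[nth u s j == prev _ _](inj_eq (can_inj (prev_next U))) next_prev //.
rewrite !nth_next // !nth_uniq ?ltn_pmod // ?(leq_trans _ s2) //.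
by congr (_ || _); rewrite eq_sym.
Qed.
End Rim.

Local Open Scope ring_scope.

(** * The extremal graphs *)

Section Isomorphism.
Variables (R : realType) (G H : sgraph).

Lemma isomorphic_sym : isomorphic G H -> isomorphic H G.
Proof.
move=> [f [g fK gK] fadj]; exists g; first by exists f.
by move=> x y; rewrite -fadj !gK.
Qed.

Lemma isomorphic_card : isomorphic G H -> #|G| = #|H|.
Proof. by move=> [f fbij _]; exact: bij_eq_card fbij. Qed.

Lemma isomorphic_contains F : isomorphic G H -> contains G F -> contains H F.
Proof.
move=> [f fbij fadj] [h hinj hadj]; exists (f \o h); first exact: inj_comp (bij_inj fbij) hinj.
by move=> x y xy; rewrite /= fadj hadj.
Qed.

Lemma isomorphic_planar : isomorphic G H -> planar R H -> planar R G.
Proof.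
move=> [f fbij fadj] [pos [curve [pinj arc vert edge]]].
have finj := bij_inj fbij.
exists (pos \o f), (fun S : {set G} => curve (f @: S)%SET); split=> [|x y xy|x y z xy|x y u v xy uv ne p].
- exact: inj_comp.
- by rewrite imsetU1 imset_set1; apply: arc; rewrite fadj.
- by rewrite imsetU1 imset_set1 => /vert; rewrite fadj => /(_ xy)[/finj|/finj]; [left|right].
- rewrite !imsetU1 !imset_set1 => /edge; rewrite !fadj => /(_ xy uv) [|z _ <-].
    by move=> E; apply: ne; apply: (imset_inj finj); rewrite !imsetU1 !imset_set1.
  by have [g _ gK] := fbij; exists (g z) => //=; rewrite gK.
Qed.

Lemma isomorphic_spectral_le : (0 < #|G|)%N -> isomorphic G H ->
  spectral_radius R H <= spectral_radius R G.
Proof.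
move=> G0 iso; have H0 : (0 < #|H|)%N by rewrite -isomorphic_card.
have [x [u [xr _ xu]]] := perron_max1 R H0; have [f [g fK gK] fadj] := iso.
apply: (spectral_radius_ge G0 (x := x \o f)); last first.
  by exists (g u); rewrite /= gK xu oner_eq0.
move=> v; rewrite /= xr (reindex f); last by exists g => y _; rewrite ?fK ?gK.
by apply: eq_bigr => y _; rewrite fadj.
Qed.
End Isomorphism.

Lemma contains_of_matching (G : sgraph) (u w : G) p (f : 'I_p * bool -> G) : adj u w ->
  injective f -> (forall e, adj u (f e) && adj w (f e)) -> (forall i, adj (f (i, false)) (f (i, true))) ->
  contains G (join (complete 2) (copies p (complete 2))).
Proof.
move=> uw finj fuw fadj.
pose h (z : join (complete 2) (copies p (complete 2))) : G :=
  match z with inl a => if a == ord0 then u else w | inr e => f (e.1, e.2 == ord0) end.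
have nuw : u != w by apply: contraTneq uw => ->; rewrite adj_irr.
have hub a e : (if a then u else w) != f e.
  by have /andP[ue we] := fuw e; case: a; [apply: contraTneq ue|apply: contraTneq we] => <-; rewrite adj_irr.
have two (a b : 'I_2) : a != b -> (b == ord0) = ~~ (a == ord0).
  by case: a b => [[|[|//]] ?] [[|[|//]] ?].
exists h.
  case=> [a|[i a]] [b|[j b]] /= E.
  - congr inl; apply/eqP; apply: contraT => /two ab; move: E; rewrite ab.
    by case: (a == _) => /= /eqP; rewrite ?[w == u]eq_sym (negPf nuw).
  - by have := hub (a == ord0) (j, b == ord0); rewrite E eqxx.
  - by have := hub (b == ord0) (i, a == ord0); rewrite E eqxx.
  - have [-> ab] := finj _ _ E; congr (inr (_, _)); apply/eqP; apply: contraT => /two.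
    by rewrite ab; case: (b == _).
case=> [a|[i a]] [b|[j b]] /=.
- by move=> /two ->; case: (a == _); rewrite //= adj_sym.
- by move=> _; have /andP[ue we] := fuw (j, b == ord0); case: (a == _).
- by move=> _; have /andP[ue we] := fuw (i, a == ord0); rewrite adj_sym; case: (b == _).
- rewrite /copies_adj /= => /andP[/eqP -> /two ->].
  by case: (a == _); rewrite //= adj_sym.
Qed.

(* [t] parametrises the spectral radius [2 t + 2] of the double wheel on [n] vertices. *)
Lemma wheel_root (R : realType) (n : nat) : (2 <= n)%N ->
  exists2 t : R, 0 <= t & t * (t * 2 + 2) = n%:R - 2.
Proof.
move=> n2; have n2' : 2 <= n%:R :> R by rewrite (ler_nat _ 2).
pose s : R := Num.sqrt (2 * n%:R - 3).
have s2 : s ^+ 2 = 2 * n%:R - 3 by rewrite sqr_sqrtr //; lra.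
have s1 : 1 <= s by rewrite -sqrtr1 ler_sqrt; lra.
exists ((s - 1) / 2); first by rewrite divr_ge0 // subr_ge0.
have -> : (s - 1) / 2 * ((s - 1) / 2 * 2 + 2) = (s ^+ 2 - 1) / 2 by field.
by rewrite s2; lra.
Qed.

Lemma extremal_iso (R : realType) (p : nat) : exists N : nat, forall (G : sgraph) (t : R),
  (N <= #|G|)%N -> planar R G -> free (join (complete 2) (copies p (complete 2))) G ->
  0 <= t -> t * (t * 2 + 2) = #|G|%:R - 2 -> t * 2 + 2 <= spectral_radius R G ->
  isomorphic G (double_wheel (#|G| - 2)).
Proof.
pose eps : R := (64 * 64)^-1.
have eps0 : 0 < eps by rewrite invr_gt0 mulr_gt0.
have eps1 : 64 * (64 * eps) = 1 by rewrite /eps; field.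
have e2 : 0 < eps ^+ 2 by rewrite exprn_gt0.
have e3 : 0 < eps ^+ 3 by rewrite exprn_gt0.
have p0 : 0 <= p%:R :> R by rewrite ler0n.
have quot (k : nat) (e : R) : 0 < e -> exists2 d : R, 0 <= d & e * d = k%:R.
  move=> e0; exists (k%:R / e); first by apply: divr_ge0 (ler0n _ _) (ltW e0).
  by rewrite mulrC divfK // gt_eqF.
have [d d0 dE] := quot 1024 _ e2.
have [c' c'0 c'E] := quot (128 * (128 * 2))%N _ e3.
(* [c] exceeds the lower bounds required of [rho], and [c'] is the one required of [n];
   [n > c ^+ 2 + c'] suffices because [rho ^+ 2 >= 2 * n]. *)
pose c : R := d + 10 * p%:R + 1.
have c_gt0 : 0 < c by rewrite /c; lra.
exists (Num.bound (c ^+ 2 + c') + 6)%N => G t GN plG freeG t0 tE t_rho.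
have n_gt : c ^+ 2 + c' < #|G|%:R.
  apply: lt_le_trans (archi_boundP _) _; first by rewrite addr_ge0 // sqr_ge0.
  by rewrite ler_nat (leq_trans _ GN) // leq_addr.
have n6 : (6 <= #|G|)%N by rewrite (leq_trans _ GN) // leq_addl.
have G0 : (0 < #|G|)%N by apply: leq_trans n6.
have rP := planar_mod2_planar plG.
have [x [u [eig x01 xu]]] := perron_max1 R G0.
move: (spectral_radius R G) t_rho eig => rho t_rho eig.
have t20 : 0 <= t * 2 + 2 by lra.
have rho0 : 0 < rho by apply: lt_le_trans t_rho; lra.
have rho2 : 2 * #|G|%:R <= rho ^+ 2.
  (* The equation for [t] gives [(t * 2 + 2) ^+ 2 = 2 * n + 4 * t]. *)
  have : (t * 2 + 2) ^+ 2 <= rho ^+ 2 by rewrite ler_pXn2r ?nnegrE // ltW.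
  by apply: le_trans; rewrite expr2; lra.
have c_rho : c <= rho.
  rewrite -(@ler_pXn2r _ 2) ?nnegrE ?(ltW c_gt0) ?(ltW rho0) //; apply: le_trans rho2; have := sqr_ge0 c; lra.
have rho_large : 1024 <= eps ^+ 2 * rho.
  by rewrite -dE ler_pM2l //; move: c_rho; rewrite /c; lra.
have n_large : 128 * (128 * 2) < eps ^+ 3 * #|G|%:R.
  by move: c'E; rewrite !natrM => <-; rewrite ltr_pM2l //; have := sqr_ge0 c; lra.
have p_rho : 10 * p%:R < rho by move: c_rho; rewrite /c; lra.
have eps1' : 64 * (64 * eps) <= 1 by rewrite eps1.
have [w wu xw] := second_vertex rP eig x01 xu eps0 eps1' rho0 rho2 rho_large n_large.
have [uw|uw] := boolP (adj u w).
  exfalso; set A := [set v | adj u v && adj w v]%SET.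
  have [dA|dA] := leqP (degsum (@adj G) A) (8 * p).
    exact: (hubs_adjacent rP eig x01 xu eps0 eps1' rho0 rho2 rho_large n_large wu xw t0 tE t_rho uw dA p_rho).
  (* A larger degree sum yields a [p]-matching in [A], which with the adjacent hubs is the forbidden
     subgraph. *)
  have A2 : {in A, forall v, (#|nbrs (@adj G) A v| <= 2)%N}.
    move=> v; rewrite inE => /andP[uv wv]; apply: (nbrs_A_le rP wu);
      [apply: contraTneq uv|apply: contraTneq wv] => ->; by rewrite adj_irr.
  have [f [finj fA fadj]] := matching_of_degsum rP A2 (ltnW dA).
  apply: freeG; apply: (contains_of_matching uw finj) => // e.
  by have := fA e; rewrite inE.
have [hubs rim2] := hubs_nonadjacent rP eig x01 xu eps0 eps1' rho0 rho2 rho_large n_large wu xw t0 tE t_rho uw.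
have [g [gbij gadj]] := double_wheel_iso rP wu uw hubs rim2 n6.
by apply: isomorphic_sym; exists g.
Qed.

Local Close Scope ring_scope.

Theorem theorem1p3 (R : realType) (p : nat) (hp : (1 <= p)%N) :
  exists N : nat, forall n : nat, (N <= n)%N -> forall G : sgraph,
    SPEX_P R n (join (complete 2) (copies p (complete 2))) G <->
    isomorphic G (join (copies 2 (complete 1)) (cycle_graph (n - 2))).
Proof.
have [N HN] := extremal_iso R p; exists (N + 6)%N => n nN G.
set F := join (complete 2) _; rewrite -/(double_wheel (n - 2)).
have n6 : (6 <= n)%N by rewrite (leq_trans _ nN) // leq_addl.
have Nn : (N <= n)%N by rewrite (leq_trans _ nN) // leq_addr.
have [t t0 tE] := @wheel_root R n (leq_trans (isT : 2 <= 6)%N n6).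
have m3 : (3 < n - 2)%N by lia.
have W_free : free_planar R n F (double_wheel (n - 2)).
  split; [by rewrite card_double_wheel //; lia|exact: double_wheel_free|].
  have -> : (n - 2 = (n - 3).+1)%N by lia.
  by apply: double_wheel_planar; lia.
have W_rho : (t * 2 + 2 <= spectral_radius R (double_wheel (n - 2)))%R.
  by apply: double_wheel_spectral => //; rewrite tE natrB // (leq_trans _ n6).
have iso (H : sgraph) : free_planar R n F H -> (t * 2 + 2 <= spectral_radius R H)%R ->
    isomorphic H (double_wheel (n - 2)).
  by move=> [Hn Hfree Hpl] Hrho; rewrite -Hn; apply: (HN H t); rewrite ?Hn.
split=> [[GF Gmax]|GW].
  by apply: iso => //; apply: le_trans W_rho _; apply: Gmax.
have [Wn Wfree Wpl] := W_free.
have Gn : #|G| = n by rewrite (isomorphic_card GW).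
have W_le (H : sgraph) : (0 < #|H|)%N -> isomorphic H (double_wheel (n - 2)) ->
    spectral_radius R (double_wheel (n - 2)) = spectral_radius R H.
  move=> H0 HW; apply/le_anti; rewrite isomorphic_spectral_le //=.
  by apply: isomorphic_spectral_le (isomorphic_sym HW); rewrite Wn; lia.
split=> [|H HF].
  split=> //; last exact: isomorphic_planar Wpl.
  by move=> /(isomorphic_contains GW).
have [Hn _ _] := HF.
rewrite -(W_le G) //; last by rewrite Gn; lia.
(* A graph beating the double wheel would be isomorphic to it and so have the same spectral
   radius. *)
rewrite leNgt; apply/negP => lt; have HW : isomorphic H (double_wheel (n - 2)).
  by apply: iso => //; apply: le_trans W_rho (ltW lt).
by rewrite (W_le H) ?ltxx // Hn in lt; lia.
Qed.
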